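(* Let $M\in\{-1,0,1\}$ and $N\ge-1$ be integers with $M+N\ge1$. Then the vectors $\{\tau^{(M,N)}(\mathbf a,\mathbf b):(\mathbf a,\mathbf b)\in\mathcal C^{M,N}\}$ (their images) form a basis of $W^{M,N}$, and $\dim W^{M,N}=2^{M+N-1}$.
   Context: Let $\mathcal H$ be the Lie algebra with basis $\bar e_i,\bar h_i,\bar f_i$ ($i\in\mathbb Z$) and brackets $[\bar e_i,\bar f_j]=\bar h_{i+j}$, all other brackets between basis elements zero. Let $\mathcal H^-$ be spanned by the basis elements with index $\le0$, and $M_{\mathcal H}=U(\mathcal H)\otimes_{U(\mathcal H^-)}\mathbb C\bar v$ the module induced from the trivial one-dimensional $\mathcal H^-$-module. With $\bar e(z)=\sum_i\bar e_iz^i$ etc., $W$ is the quotient of $M_{\mathcal H}$ by the span of all $z$-coefficients of $\bar e(z)^2u,\bar f(z)^2u,\bar e(z)\bar h(z)u,\bar f(z)\bar h(z)u,\bar h(z)^2u$, $u\in M_{\mathcal H}$. For integers $M,N\ge-1$ with $(M,N)\ne(-1,-1)$ let $\mathfrak g(M,N)\subset\mathcal H$ be the subalgebra generated by $\bar e_i$ ($i\ge M$) and $\bar f_j$ ($j\ge N$), and $\overline W^{M,N}=W/\mathfrak g(M,N)W$; set $W^{M,N}=\overline W^{M,N}$ if $M,N\ge0$ and $W^{M,N}=\overline W^{M,N}/\mathbb C\bar v$ if $M=-1$ or $N=-1$. Sets of $0/1$ sequences: in all conditions below, entries whose index is outside the given range are read as $0$. ''Triangle relations'': $b_{i+1}+a_{i+1}+a_i\le1$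 and $b_{i+1}+b_i+a_i\le1$ for all $i$. ''Right neighbour condition'': for each $i$ with $b_i\ne0$ there is $j>i$ with $a_j\ne0$ and $b_s=0$ for $i+1\le s\le j$. $\mathcal C^{0,N}$ is the set of $(a_{N-1},\dots,a_0;b_{N-1},\dots,b_1)\in\{0,1\}^{2N-1}$ satisfying the triangle relations, the right neighbour condition and $a_0=0$; $\tau^{(0,N)}(\mathbf a,\mathbf b)=\bar f_{N-1}^{a_{N-1}}\bar h_{N-1}^{b_{N-1}}\cdots\bar f_1^{a_1}\bar h_1^{b_1}\bar v$. $\mathcal C^{1,N}$ is the set of $(a_N,\dots,a_0;b_N,\dots,b_1)\in\{0,1\}^{2N+1}$ satisfying the triangle relations, the right neighbour condition, and: there is $j$ with $a_j\ne0$ and $b_s=0$ for all $s\le j$; $\tau^{(1,N)}(\mathbf a,\mathbf b)=\bar h_N^{b_N}\bar f_{N-1}^{a_N}\bar h_{N-1}^{b_{N-1}}\cdots\bar f_1^{a_2}\bar h_1^{b_1}\bar f_0^{a_1}\bar e_1^{1-a_0}\bar v$. $\mathcal C^{-1,N}=\mathcal C^{1,N-2}$, and for $(a_{N-2},\dots,a_0;b_{N-2},\dots,b_1)\in\mathcal C^{-1,N}$, $\tau^{(-1,N)}(\mathbf a,\mathbf b)=\bar f_{N-1}^{a_{N-2}}\bar f_{N-2}^{a_{N-3}}\bar h_{N-2}^{b_{N-2}}\cdots\bar f_2^{a_1}\bar h_2^{b_2}\bar f_1^{a_0}\bar h_1^{b_1}\bar v$. *)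

(* Defs.v *)
From HB Require Import structures.
From mathcomp Require Import all_boot all_order all_algebra.
Set Implicit Arguments. Unset Strict Implicit. Unset Printing Implicit Defensive.
Import Order.TTheory GRing.Theory Num.Theory.
Local Open Scope ring_scope.

Inductive kind := KE | KH | KF.
Definition kind_eqb (a b : kind) : bool :=
  match a, b with KE, KE | KH, KH | KF, KF => true | _, _ => false end.
Lemma kind_eqP : Equality.axiom kind_eqb.
Proof. by case; case; constructor. Qed.
HB.instance Definition _ := hasDecEq.Build kind kind_eqP.

(* A basis element of H: (KE,i) = bar e_i, (KH,i) = bar h_i, (KF,i) = bar f_i. *)
Definition gen := (kind * int)%type.
(* A word [:: g1; ...; gk] stands for the monomial g1 g2 ... gk of the tensor
   algebra T(H); acting on bar v it is g1 (g2 (... (gk v))). *)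
Definition word := seq gen.

Section Defs.
Variable K : fieldType.

(* The free K-vector space on words (= T(H)); we only ever use finitely
   supported elements, built from the basis vectors dlt w. *)
Definition vec := word -> K.
Definition dlt (w : word) : vec := fun x => (x == w)%:R.

Inductive spanP (G : vec -> Prop) : vec -> Prop :=
| span0 : spanP G (fun _ => 0)
| spanG u : G u -> spanP G u
| spanD u v : spanP G u -> spanP G v -> spanP G (fun x => u x + v x)
| spanZ (c : K) u : spanP G u -> spanP G (fun x => c * u x).

(* p [x,y] q  where [x,y] is the Lie bracket of H: [e_i,f_j] = h_{i+j}. *)
Definition brv (p : word) (x y : gen) (q : word) : vec :=
  match x.1, y.1 with
  | KE, KF => dlt (p ++ (KH, x.2 + y.2) :: q)
  | KF, KE => fun w => - dlt (p ++ (KH, x.2 + y.2) :: q) w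
  | _, _ => fun _ => 0
  end.

(* p (x y - y x - [x,y]) q : generators of the ideal defining U(H). *)
Definition commrel (p : word) (x y : gen) (q : word) : vec :=
  fun w => dlt (p ++ x :: y :: q) w - dlt (p ++ y :: x :: q) w - brv p x y q w.

(* Kernel of T(H) -> M_H = U(H) (x)_{U(H^-)} C v:
   two-sided ideal of U(H) plus the left ideal T(H) H^-. *)
Definition Jgen (u : vec) : Prop :=
  (exists p x y q, u = commrel p x y q) \/
  (exists (p : word) (x : gen), x.2 <= 0 /\ u = dlt (rcons p x)).
Definition MHker : vec -> Prop := spanP Jgen.

(* Pairs (k1,k2) for the relations e(z)^2, f(z)^2, e(z)h(z), f(z)h(z), h(z)^2. *)
Definition relpairs : seq (kind * kind) :=
  [:: (KE, KE); (KF, KF); (KE, KH); (KF, KH); (KH, KH)].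

(* The z^n-coefficient of k1(z) k2(z) u (u = word w): sum over i of
   (k1,i)(k2,n-i) w, which has finitely many nonzero terms in M_H; it is
   computed over any window [L, L+len) outside of which all terms vanish in M_H. *)
Definition Rgen (u : vec) : Prop :=
  exists (k1 k2 : kind) (n : int) (w : word) (L : int) (len : nat),
    (k1, k2) \in relpairs /\
    (forall i : int, (i < L \/ L + len%:Z <= i) ->
        MHker (dlt ((k1, i) :: (k2, n - i) :: w))) /\
    u = (fun x => \sum_(t < len)
           dlt ((k1, L + t%:Z) :: (k2, n - (L + t%:Z)) :: w) x).

(* Lie expressions: elements of the Lie subalgebra generated by a set of basis
   elements are the values of expressions whose leaves lie in that set. *)
Inductive lexpr :=
| LGen of gen
| LBr of lexpr & lexpr
| LAdd of lexpr & lexpr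
| LScale of K & lexpr.

Fixpoint leaves_in (P : pred gen) (l : lexpr) : bool :=
  match l with
  | LGen g => P g
  | LBr a b => leaves_in P a && leaves_in P b
  | LAdd a b => leaves_in P a && leaves_in P b
  | LScale _ a => leaves_in P a
  end.

Definition pre (g : gen) (u : vec) : vec :=
  fun x => if x is g' :: x' then (if g' == g then u x' else 0) else 0.

Fixpoint act (l : lexpr) (u : vec) : vec :=
  match l with
  | LGen g => pre g u
  | LBr a b => fun x => act a (act b u) x - act b (act a u) x
  | LAdd a b => fun x => act a u x + act b u x
  | LScale c a => fun x => c * act a u x
  end.

Definition gMN_gen (M N : int) : pred gen :=
  fun g => ((g.1 == KE) && (M <= g.2)) || ((g.1 == KF) && (N <= g.2)).

Definition gWgen (M N : int) (u : vec) : Prop :=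
  exists (l : lexpr) (w : word), leaves_in (gMN_gen M N) l /\ u = act l (dlt w).

Definition vgen (M N : int) (u : vec) : Prop :=
  ((M == -1) || (N == -1)) /\ u = dlt [::].

(* Kernel of T(H) -> W^{M,N}. *)
Definition Wker (M N : int) : vec -> Prop :=
  spanP (fun u => MHker u \/ Rgen u \/ gWgen M N u \/ vgen M N u).

End Defs.

(* 0/1 sequences with indices 0..n : a = (a_0..a_n), b = (b_0..b_n) with b_0 = 0
   (b_0 is outside the range of b). *)
Definition seqs (n : nat) := ({ffun 'I_n.+1 -> bool} * {ffun 'I_n.+1 -> bool})%type.

Definition rd (n : nat) (a : {ffun 'I_n.+1 -> bool}) (i : nat) : bool :=
  if (i <= n)%N then a (inord i) else false.

Definition triangle n (x : seqs n) : bool :=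
  [forall i : 'I_n.+1,
     ((rd x.2 i.+1 + rd x.1 i.+1 + rd x.1 i <= 1)%N &&
      (rd x.2 i.+1 + rd x.2 i + rd x.1 i <= 1)%N)].

Definition rightnb n (x : seqs n) : bool :=
  [forall i : 'I_n.+1, rd x.2 i ==>
     [exists j : 'I_n.+1, ((i < j)%N && rd x.1 j) &&
        [forall s : 'I_n.+1, ((i < s)%N && (s <= j)%N) ==> ~~ rd x.2 s]]].

Definition baseC n (x : seqs n) : bool :=
  ~~ x.2 ord0 && triangle x && rightnb x.

(* C^{0,N} with n = N-1 *)
Definition C0 n : {set seqs n} := [set x | baseC x && ~~ rd x.1 0].
(* C^{1,N} with n = N *)
Definition C1 n : {set seqs n} :=
  [set x | baseC x &&
     [exists j : 'I_n.+1, rd x.1 j && [forall s : 'I_n.+1, (s <= j)%N ==> ~~ rd x.2 s]]].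

(* top index: N-1 for M=0, N for M=1, N-2 for M=-1 (C^{-1,N} = C^{1,N-2}) *)
Definition top (M N : int) : nat := absz (N + M - 1)%R.

Definition Cset (M N : int) : {set seqs (top M N)} :=
  if M == 0 then C0 (top M N) else C1 (top M N).

Definition opt (c : bool) (g : gen) : word := if c then [:: g] else [::].

(* f_{n}^{a_n} h_n^{b_n} ... f_1^{a_1} h_1^{b_1} v   (n = N-1) *)
Definition tau0 n (x : seqs n) : word :=
  flatten [seq opt (rd x.1 k) (KF, k%:Z) ++ opt (rd x.2 k) (KH, k%:Z)
          | k <- rev (iota 1 n)].
(* h_n^{b_n} f_{n-1}^{a_n} ... h_1^{b_1} f_0^{a_1} e_1^{1-a_0} v   (n = N) *)
Definition tau1 n (x : seqs n) : word :=
  flatten [seq opt (rd x.2 k) (KH, k%:Z) ++ opt (rd x.1 k) (KF, (k.-1)%:Z)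
          | k <- rev (iota 1 n)] ++ opt (~~ rd x.1 0) (KE, 1).
(* f_{n+1}^{a_n} f_n^{a_{n-1}} h_n^{b_n} ... f_1^{a_0} h_1^{b_1} v   (n = N-2) *)
Definition taum n (x : seqs n) : word :=
  opt (rd x.1 n) (KF, (n.+1)%:Z) ++
  flatten [seq opt (rd x.1 k.-1) (KF, k%:Z) ++ opt (rd x.2 k) (KH, k%:Z)
          | k <- rev (iota 1 n)].

Definition tau (M N : int) (x : seqs (top M N)) : word :=
  if M == 0 then tau0 x else if M == 1 then tau1 x else taum x.

(* Main.v *)
(*
  Spanning. The relation f(z)^2 = 0 and the commutators make left multiplication
  by f_{N-1} and by h_{M+N} well defined between quotients of W, and this gives
  right exact sequences
    W^{M+1,N-2} --f_{N-1}--> W^{M,N} --> W^{M,N-1} --> 0,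
    W^{M,N-1} --h_{M+N}--> W^{M+1,N} --> W^{M+1,N} / h_{M+N} W^{M+1,N} --> 0,
    W^{M+1,N-2} --f_{N-1}--> W^{M+1,N} / h_{M+N} W^{M+1,N} --> W^{M+1,N-1} --> 0.
  Scanning a configuration (a, b) from the top, the sets C^{M,N} satisfy the same
  recursion, so the vectors tau span W^{M,N}; also #|C^{M,N}| = 2^(M+N-1).

  Independence. H acts on a semi-infinite fermionic Fock space with three rows of
  sites by e(z) = psi_1(z) psi_2^*(z), f(z) = psi_2(z) psi_3^*(z) and
  h(z) = psi_1(z) psi_3^*(z); the quadratic relations hold because psi_1 and
  psi_3^* anticommute with themselves. The coefficient of the configuration with
  second row filled exactly up to d, set S of particles in the first row and set
  T of holes in the third row is a functional on W. It kills g(M,N) W when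
  S lies in [1, M+d] and T in (d-N, 0]. Pairing with f_{N-1} w either gives 0 or
  removes the extremal hole, which leads from (M,N) to (M+1,N-2), and similarly
  for e_{M-1}; by induction one gets 2^(M+N-1) independent functionals, and a
  square pairing matrix forces the tau vectors to be independent.
*)
Require Import Defs.
From HB Require Import structures.
From mathcomp Require Import all_boot all_order all_algebra.
From mathcomp Require Import boolp functions zify ring.
Set Implicit Arguments. Unset Strict Implicit. Unset Printing Implicit Defensive.
Import Order.TTheory GRing.Theory Num.Theory.
Local Open Scope ring_scope.

(** * Linear algebra of the presentation *)

Section Subspaces.
Variable K : fieldType.
Implicit Types (u v : vec K) (w : word) (g : gen) (Q : vec K -> Prop).

Lemma vec0E x : (0 : vec K) x = 0. Proof. by []. Qed.
Lemma vecDE u v x : (u + v) x = u x + v x. Proof. by []. Qed.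
Lemma vecNE u x : (- u) x = - u x. Proof. by []. Qed.
Definition vecE := (vec0E, vecDE, vecNE).

Record subspace Q : Prop := Subspace {
  sub0 : Q 0;
  subD : forall u v, Q u -> Q v -> Q (u + v);
  subZ : forall (c : K) u, Q u -> Q (fun x => c * u x) }.

Lemma subN Q : subspace Q -> forall u, Q u -> Q (- u).
Proof.
move=> hQ u /(subZ hQ (-1)); congr Q; apply/funext => x.
by rewrite mulN1r.
Qed.

Lemma subB Q : subspace Q -> forall u v, Q u -> Q v -> Q (u - v).
Proof. by move=> hQ u v hu hv; apply: subD => //; apply: subN. Qed.

Lemma subDK Q u v : subspace Q -> Q v -> Q (u + v) -> Q u.
Proof. by move=> hQ hv /(subB hQ)/(_ hv); rewrite addrK. Qed.

Lemma sub_sum Q (I : eqType) (r : seq I) (P : pred I) (F : I -> vec K) :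
  subspace Q -> (forall i, i \in r -> P i -> Q (F i)) -> Q (\sum_(i <- r | P i) F i).
Proof.
move=> hQ hF; rewrite big_seq_cond; apply: (big_ind Q) => [||i /andP[]].
- exact: sub0.
- exact: subD.
- exact: hF.
Qed.

Lemma sub_eqm Q u v : subspace Q -> Q (u - v) -> Q v -> Q u.
Proof. by move=> hQ h1 h2; rewrite -(subrK v u); apply: subD. Qed.

Lemma subspace_spanP (G : vec K -> Prop) : subspace (spanP G).
Proof.
split; first exact: span0.
- by move=> u v hu hv; apply: spanD.
- by move=> c u hu; apply: spanZ.
Qed.

Lemma spanP_min (G : vec K -> Prop) Q : subspace Q ->
  (forall u, G u -> Q u) -> forall u, spanP G u -> Q u.
Proof.
move=> hQ hG u; elim => [|{}u /hG //|{}u v _ hu _ hv|c {}u _ hu].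
- exact: sub0.
- exact: subD.
- exact: subZ.
Qed.

Lemma spanP_mono (G G' : vec K -> Prop) : (forall u, G u -> G' u) ->
  forall u, spanP G u -> spanP G' u.
Proof.
by move=> h; apply: spanP_min => [|u /h]; [apply: subspace_spanP|apply: spanG].
Qed.

Record linop (F : vec K -> vec K) : Prop := Linop {
  lin0 : F 0 = 0;
  linD : forall u v, F (u + v) = F u + F v;
  linZ : forall (c : K) u, F (fun x => c * u x) = (fun x => c * F u x) }.

Lemma subspace_preim Q F : subspace Q -> linop F -> subspace (fun u => Q (F u)).
Proof.
move=> hQ hF; split; first by rewrite lin0 //; apply: sub0.
- by move=> u v hu hv; rewrite linD //; apply: subD.
- by move=> c u hu; rewrite linZ //; apply: subZ.
Qed.

Lemma linN F : linop F -> forall u, F (- u) = - F u.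
Proof.
by move=> hF u; apply/eqP; rewrite -addr_eq0 -linD // addNr lin0.
Qed.

Lemma linB F : linop F -> forall u v, F (u - v) = F u - F v.
Proof. by move=> hF u v; rewrite linD // linN. Qed.

Lemma lin_sum F (I : Type) (r : seq I) (P : pred I) (G : I -> vec K) :
  linop F -> F (\sum_(i <- r | P i) G i) = \sum_(i <- r | P i) F (G i).
Proof. by move=> hF; apply: big_morph; [apply: linD|apply: lin0]. Qed.

Lemma linop_id : linop id. Proof. by []. Qed.

Lemma linop_pre g : linop (pre g).
Proof.
split=> [|u v|c u]; apply/funext => -[|g' x] //=.
- by case: ifP.
- by rewrite vecE /= addr0.
- by rewrite !vecE /=; case: ifP; rewrite ?addr0.
- by rewrite mulr0.
- by case: ifP; rewrite ?mulr0.
Qed.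

Lemma pre_dlt g w : pre g (dlt K w) = dlt K (g :: w).
Proof.
apply/funext => -[|g' x]; rewrite /dlt //= eqseq_cons.
by case: eqP.
Qed.

Definition fin u := spanP (fun v => exists w, v = dlt K w) u.

Lemma fin_dlt w : fin (dlt K w). Proof. by apply: spanG; exists w. Qed.

Lemma fin_act l u : fin u -> fin (act l u).
Proof.
elim: l u => [g|a ha b hb|a ha b hb|c a ha] u hu /=.
- move: hu; apply: (@spanP_min _ (fun u => fin (pre g u))) => [|_ [w ->]].
    exact: subspace_preim (subspace_spanP _) (linop_pre g).
  by rewrite pre_dlt; apply: fin_dlt.
- by apply: (subB (subspace_spanP _)); [apply/ha/hb|apply/hb/ha].
- by apply: (subD (subspace_spanP _)); [apply/ha|apply/hb].
- by apply: (subZ (subspace_spanP _)); apply/ha.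
Qed.

(** Every word in the expansion of a Lie expression begins with one of its leaves, so only the
    generators themselves need checking; finite support of [u] lets the rest be split into words. *)
Lemma act_sub M N Q F : subspace Q -> linop F ->
  (forall g w, gMN_gen M N g -> Q (F (dlt K (g :: w)))) ->
  forall l u, leaves_in (gMN_gen M N) l -> fin u -> Q (F (act l u)).
Proof.
move=> hQ hF hg; elim => [g|a ha b hb|a ha b hb|c a ha] u /=.
- move=> hl; apply: (@spanP_min _ (fun u => Q (F (pre g u)))) => [|_ [w ->]].
    exact: subspace_preim (subspace_preim hQ hF) (linop_pre g).
  by rewrite pre_dlt; apply: hg.
- case/andP => la lb fu.
  rewrite -[F _]/(F (act a (act b u) - act b (act a u))) (linB hF).
  by apply: (subB hQ); [apply: ha|apply: hb] => //; apply: fin_act.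
- case/andP => la lb fu.
  rewrite -[F _]/(F (act a u + act b u)) (linD hF).
  by apply: (subD hQ); [apply: ha|apply: hb].
- by move=> la fu; rewrite (linZ hF); apply: (subZ hQ); apply: ha.
Qed.

Definition Wgen M N u :=
  @MHker K u \/ @Rgen K u \/ @gWgen K M N u \/ @vgen K M N u.

Lemma Wgen_sub M N Q F : subspace Q -> linop F ->
  (forall u, MHker u -> Q (F u)) -> (forall u, Rgen u -> Q (F u)) ->
  (forall g w, gMN_gen M N g -> Q (F (dlt K (g :: w)))) ->
  ((M == -1) || (N == -1) -> Q (F (dlt K [::]))) ->
  forall u, Wgen M N u -> Q (F u).
Proof.
move=> hQ hF h1 h2 h3 h4 u [/h1 //|[/h2 //|[|]]].
- by case=> [l [w [hl ->]]]; apply: (act_sub hQ hF h3 hl (fin_dlt w)).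
- by case=> /h4 h ->.
Qed.

(* The kernel of T(H) -> W^{M,N} / span(ws). *)
Definition quo M N (ws : word -> Prop) u :=
  spanP (fun u => Wgen M N u \/ exists2 w, ws w & u = dlt K w) u.
Definition spans M N ws := forall w, quo M N ws (dlt K w).

Lemma subspace_quo M N ws : subspace (quo M N ws).
Proof. exact: subspace_spanP. Qed.

Lemma quo_Wgen M N ws u : Wgen M N u -> quo M N ws u.
Proof. by move=> h; apply: spanG; left. Qed.

Lemma quo_MH M N ws u : MHker u -> quo M N ws u.
Proof. by move=> h; apply: quo_Wgen; left. Qed.

Lemma quo_R M N ws u : Rgen u -> quo M N ws u.
Proof. by move=> h; apply: quo_Wgen; right; left. Qed.

Lemma quo_g M N ws g w : gMN_gen M N g -> quo M N ws (dlt K (g :: w)).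
Proof.
move=> h; apply: quo_Wgen; right; right; left.
by exists (LGen K g), w; rewrite /= pre_dlt.
Qed.

Lemma quo_v M N ws : (M == -1) || (N == -1) -> quo M N ws (dlt K [::]).
Proof. by move=> h; apply: quo_Wgen; right; right; right. Qed.

Lemma quo_ws M N ws w : ws w -> quo M N ws (dlt K w).
Proof. by move=> h; apply: spanG; right; exists w. Qed.

(** A linear [F] that sends the relations of W^{M,N} into [Q] descends to the quotient, where a
    spanning set decides. This is how right exactness is used. *)
Lemma spans_sub M N ws Q F : subspace Q -> linop F -> spans M N ws ->
  (forall u, MHker u -> Q (F u)) -> (forall u, Rgen u -> Q (F u)) ->
  (forall g w, gMN_gen M N g -> Q (F (dlt K (g :: w)))) ->
  ((M == -1) || (N == -1) -> Q (F (dlt K [::]))) ->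
  (forall w, ws w -> Q (F (dlt K w))) ->
  forall w, Q (F (dlt K w)).
Proof.
move=> hQ hF hs h1 h2 h3 h4 h5 w.
move: (hs w); apply: (@spanP_min _ (fun u => Q (F u))) => [|u].
  exact: subspace_preim.
by case=> [|[w' /h5 h ->] //]; apply: (Wgen_sub hQ hF h1 h2 h3 h4).
Qed.

End Subspaces.

(** * Quadratic relations as sums over finite windows of modes *)

Definition int_ball (B : nat) : seq int :=
  [seq t%:Z - B%:Z | t <- iota 0 (B.*2).+1].

Lemma uniq_int_ball B : uniq (int_ball B).
Proof. by rewrite map_inj_uniq ?iota_uniq // => x y; lia. Qed.

Lemma mem_int_ball B i : (i \in int_ball B) = (`|i| <= B)%N.
Proof.
apply/mapP/idP => [[t]|h].
  by rewrite mem_iota; lia.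
exists (absz (i + B%:Z)); last by lia.
by rewrite mem_iota; lia.
Qed.

Section Relations.
Variable K : fieldType.
Implicit Types (u v : vec K) (w p q : word) (g x y : gen) (Q : vec K -> Prop).

Lemma subspace_MH : subspace (@MHker K). Proof. exact: subspace_spanP. Qed.

Lemma commrelE p x y q : commrel K p x y q =
  dlt K (p ++ x :: y :: q) - dlt K (p ++ y :: x :: q) - brv K p x y q.
Proof. by []. Qed.

Lemma pre_brv g p x y q : pre g (brv K p x y q) = brv K (g :: p) x y q.
Proof.
rewrite /brv; case: x.1; case: y.1; rewrite -?pre_dlt //;
  try exact: (lin0 (linop_pre _ _)).
exact: (linN (linop_pre _ _)).
Qed.

Lemma MH_pre g u : MHker u -> MHker (pre g u).
Proof.
apply: (@spanP_min _ _ (fun u => MHker (pre g u))).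
  exact: subspace_preim subspace_MH (linop_pre _ _).
move=> {}u [[p [x [y [q ->]]]]|[p [x [hx ->]]]]; apply: spanG.
- left; exists (g :: p), x, y, q.
  by rewrite !commrelE !(linB (linop_pre _ _)) pre_brv !pre_dlt.
- by right; exists (g :: p), x; rewrite pre_dlt.
Qed.

Lemma MH_commrel p x y q : MHker (commrel K p x y q).
Proof. by apply: spanG; left; exists p, x, y, q. Qed.

Section Ambient.
Variable Q : vec K -> Prop.
Hypothesis (hQ : subspace Q) (hMH : forall u, MHker u -> Q u).

Lemma swap p x y q :
  Q (dlt K (p ++ y :: x :: q)) -> Q (brv K p x y q) -> Q (dlt K (p ++ x :: y :: q)).
Proof.
move=> h1 h2; apply: (sub_eqm hQ _ h1); apply: (sub_eqm hQ _ h2).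
by apply: hMH; rewrite -commrelE; apply: MH_commrel.
Qed.

Lemma swap0 x y q : Q (dlt K (y :: x :: q)) -> Q (brv K [::] x y q) ->
  Q (dlt K (x :: y :: q)).
Proof. exact: (@swap [::]). Qed.

Lemma swap0H x y q : Q (dlt K (y :: x :: q)) ->
  (x.1 != y.1 -> x.1 != KH -> y.1 != KH -> Q (dlt K ((KH, x.2 + y.2) :: q))) ->
  Q (dlt K (x :: y :: q)).
Proof.
move=> h1 h2; apply: swap0 => //.
move: h2; rewrite /brv; case: x.1; case: y.1 => //= h;
  try exact: (sub0 hQ); try exact: h.
by apply: (subN hQ); apply: h.
Qed.

Lemma sub_window (F : int -> vec K) (s1 s2 : seq int) : uniq s1 -> uniq s2 ->
  (forall i, i \in s1 -> i \notin s2 -> Q (F i)) ->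
  (forall i, i \in s2 -> i \notin s1 -> Q (F i)) ->
  Q (\sum_(i <- s1) F i) -> Q (\sum_(i <- s2) F i).
Proof.
move=> u1 u2 h1 h2.
rewrite (bigID (mem s2)) /= [in X in _ -> X](bigID (mem s1)) /=.
have -> : \sum_(i <- s1 | i \in s2) F i = \sum_(i <- s2 | i \in s1) F i.
  rewrite -[LHS]big_filter -[RHS]big_filter; apply: perm_big.
  apply: uniq_perm; rewrite ?filter_uniq // => i.
  by rewrite !mem_filter andbC.
move=> h; apply: (subD hQ); last by apply: sub_sum => // i hi; apply: h2.
by have := subB hQ h (sub_sum (P := fun i => i \notin s2) hQ h1); rewrite addrK.
Qed.

End Ambient.

(** A very negative mode moves right until it kills the vacuum; each commutator leaves an [h] mode
    that is still very negative, whence the second use of the induction hypothesis, at [KH]. *)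
Lemma MH_small k w : exists B : nat, forall i : int, i <= - B%:Z ->
  MHker (dlt K ((k, i) :: w)).
Proof.
elim: w k => [|g w ih] k.
  by exists 0 => i hi; apply: spanG; right; exists [::], (k, i); split=> //=; lia.
have [B1 h1] := ih k; have [B2 h2] := ih KH.
exists (B1 + B2 + `|g.2|)%N => i hi.
apply: (swap0H subspace_MH) => // [|_ _ _].
  by rewrite -pre_dlt; apply/MH_pre/h1; lia.
by apply: h2; rewrite /=; lia.
Qed.

Lemma relpair_comm k1 k2 : (k1, k2) \in relpairs ->
  ~~ [&& k1 != k2, k1 != KH & k2 != KH].
Proof. by case: k1; case: k2. Qed.

Lemma rel_comm Q k1 k2 i j w : subspace Q -> (forall u, MHker u -> Q u) ->
  (k1, k2) \in relpairs ->
  Q (dlt K ((k2, j) :: (k1, i) :: w)) -> Q (dlt K ((k1, i) :: (k2, j) :: w)).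
Proof.
move=> hQ hMH hr h; apply: (swap0H hQ) => //= a b c.
by have := relpair_comm hr; rewrite a b c.
Qed.

(** The two modes commute, so whichever of the two is very negative can be placed next to [w]. *)
Lemma rel_bound k1 k2 n w : (k1, k2) \in relpairs ->
  exists B : nat, forall i : int, (B <= `|i|)%N ->
    MHker (dlt K ((k1, i) :: (k2, n - i) :: w)).
Proof.
move=> hr; have [B1 h1] := MH_small k1 w; have [B2 h2] := MH_small k2 w.
exists (B1 + B2 + `|n|)%N => i hi.
have [i0|i0] := lerP 0 i.
  by rewrite -pre_dlt; apply/MH_pre/h2; lia.
apply: (rel_comm subspace_MH) => //.
by rewrite -pre_dlt; apply/MH_pre/h1; lia.
Qed.

Section Rel.
Variable Q : vec K -> Prop.
Hypothesis (hQ : subspace Q) (hMH : forall u, MHker u -> Q u).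
Hypothesis (hR : forall u, Rgen u -> Q u).

(** Terms outside the window of [Rgen] vanish in M_H, so the relation may be summed over any finite
    set containing a large ball. *)
Lemma rel_sum k1 k2 n w : (k1, k2) \in relpairs ->
  exists B : nat, forall s, uniq s -> (forall i : int, (`|i| <= B)%N -> i \in s) ->
    Q (\sum_(i <- s) dlt K ((k1, i) :: (k2, n - i) :: w)).
Proof.
move=> hr; have [B hB] := rel_bound n w hr; exists B => s us hs.
apply: (@sub_window Q hQ _ (int_ball B) s) => //; first exact: uniq_int_ball.
- by move=> i; rewrite mem_int_ball => /hs ->.
- by move=> i _; rewrite mem_int_ball => hi; apply/hMH/hB; lia.
apply: hR; exists k1, k2, n, w, (- B%:Z), (B.*2).+1; split=> //; split.
  by move=> i hi; apply: hB; lia.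
rewrite /int_ball big_map.
rewrite (_ : iota 0 _ = index_iota 0 (B.*2).+1) ?big_mkord; last first.
  by rewrite /index_iota subn0.
rewrite fct_sumE; apply/funext => x; apply: eq_bigr => t _.
by rewrite ![t%:Z - _]addrC.
Qed.

Lemma rel_one k1 k2 n w i0 : (k1, k2) \in relpairs ->
  (forall i, i != i0 -> Q (dlt K ((k1, i) :: (k2, n - i) :: w))) ->
  Q (dlt K ((k1, i0) :: (k2, n - i0) :: w)).
Proof.
move=> hr h; have [B hB] := rel_sum n w hr.
have hs i : (`|i| <= B)%N -> i \in int_ball (B + `|i0|)%N by rewrite mem_int_ball; lia.
have := hB _ (uniq_int_ball _) hs.
have m0 : i0 \in int_ball (B + `|i0|)%N by rewrite mem_int_ball leq_addl.
rewrite (bigD1_seq i0 m0 (uniq_int_ball _)) /=.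
apply: (subDK hQ).
by apply: sub_sum => // i _; apply: h.
Qed.

Lemma rel_two k1 k2 n w i0 i1 : (k1, k2) \in relpairs -> i0 != i1 ->
  (forall i, i != i0 -> i != i1 -> Q (dlt K ((k1, i) :: (k2, n - i) :: w))) ->
  Q (dlt K ((k1, i0) :: (k2, n - i0) :: w) + dlt K ((k1, i1) :: (k2, n - i1) :: w)).
Proof.
move=> hr h01 h; have [B hB] := rel_sum n w hr.
have hs i : (`|i| <= B)%N -> i \in int_ball (B + `|i0| + `|i1|)%N.
  by rewrite mem_int_ball; lia.
have := hB _ (uniq_int_ball _) hs.
have m0 : i0 \in int_ball (B + `|i0| + `|i1|)%N by rewrite mem_int_ball; lia.
have m1 : i1 \in [seq i <- int_ball (B + `|i0| + `|i1|)%N | i != i0].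
  by rewrite mem_filter eq_sym h01 mem_int_ball leq_addl.
rewrite (bigD1_seq i0 m0 (uniq_int_ball _)) /=.
rewrite -big_filter (bigD1_seq i1 m1 (filter_uniq _ (uniq_int_ball _))).
rewrite big_filter_cond addrA; apply: (subDK hQ).
by apply: sub_sum => // i _ /andP[]; apply: h.
Qed.

End Rel.
End Relations.

(** * Right exact sequences between the spaces W^{M,N} *)

Section Steps.
Variable K : fieldType.
Implicit Types (u v : vec K) (w p q : word) (g x y : gen).

Lemma comm_diff x y q : ~~ [&& x.1 != y.1, x.1 != KH & y.1 != KH] ->
  MHker (dlt K (x :: y :: q) - dlt K (y :: x :: q)).
Proof.
move=> h; suff -> : dlt K (x :: y :: q) - dlt K (y :: x :: q) = commrel K [::] x y q.
  exact: MH_commrel.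
rewrite commrelE (_ : brv _ _ _ _ _ = 0) ?subr0 //.
by move: h; rewrite /brv; case: x.1; case: y.1.
Qed.

Section RgenStable.
Variable Q : vec K -> Prop.
Hypothesis (hQ : subspace Q) (hMH : forall u, MHker u -> Q u).
Hypothesis (hR : forall u, Rgen u -> Q u).

(** The bound on preimages makes the [f]-image of a large ball contain a ball on which the relation
    already holds. *)
Lemma rel_reindex k1 k2 n w (f : int -> int) (c : nat) : (k1, k2) \in relpairs ->
  injective f -> (forall j, exists2 i, f i = j & (`|i| <= `|j| + c)%N) ->
  exists B0, forall B, (B0 <= B)%N ->
    Q (\sum_(i <- int_ball B) dlt K ((k1, f i) :: (k2, n - f i) :: w)).
Proof.
move=> hr fI fS; have [B hB] := rel_sum hQ hMH hR n w hr.
exists (B + c)%N => B' hB'.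
have := hB (map f (int_ball B')); rewrite big_map; apply.
  by rewrite map_inj_uniq ?uniq_int_ball.
move=> j hj; have [i fi hi] := fS j.
by rewrite -fi; apply: map_f; rewrite mem_int_ball; lia.
Qed.

(** These terms come from [e_i, f_j] = h_{i+j}. For [k2 = KH] they form a shifted coefficient of
    h(z)^2, for [k2 = KE] a reflected one of e(z)h(z), whose factors commute. *)
Lemma rel_bracket_l j k2 n w : (KE, k2) \in relpairs ->
  exists B0, forall B, (B0 <= B)%N ->
    Q (\sum_(i <- int_ball B) dlt K ((KH, j + i) :: (k2, n - i) :: w)).
Proof.
case: k2 => // _.
- have [B0 h] := @rel_reindex KE KH (n + j) w (fun i => n - i) `|n| isT
    (fun a b => ltac:(lia)) (fun i => ltac:(exists (n - i); lia)).
  exists B0 => B /h; apply: (sub_eqm hQ); rewrite -sumrB.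
  apply: sub_sum => // i _ _; apply: hMH.
  by rewrite (_ : n + j - (n - i) = j + i); [apply: comm_diff|ring].
- have [B0 h] := @rel_reindex KH KH (n + j) w (fun i => j + i) `|j| isT
    (fun a b => ltac:(lia)) (fun i => ltac:(exists (i - j); lia)).
  exists B0 => B /h; congr Q; apply: eq_bigr => i _.
  by congr (dlt K [:: _, (_, _) & _]); ring.
Qed.

Lemma rel_bracket_r j n w : exists B0, forall B, (B0 <= B)%N ->
    Q (\sum_(i <- int_ball B) dlt K ((KE, i) :: (KH, j + (n - i)) :: w)).
Proof.
have [B0 h] := @rel_reindex KE KH (n + j) w id 0 isT
    (fun a b => ltac:(lia)) (fun i => ltac:(exists i; lia)).
exists B0 => B /h; congr Q; apply: eq_bigr => i _.
by congr (dlt K [:: _, (_, _) & _]); ring.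
Qed.

(* Commuting f_j past e(z)^2 and e(z)h(z) produces only coefficients of
   e(z)h(z) and h(z)^2; the other relations commute with f_j and h_j. *)
Lemma Rgen_pre g u : g.1 != KE -> Rgen u -> Q (pre g u).
Proof.
move=> hg [k1 [k2 [n [w [L [len [hr [hout ->]]]]]]]].
pose F i := dlt K ((k1, i) :: (k2, n - i) :: w).
pose s0 := [seq L + t%:Z | t <- iota 0 len].
have -> : (fun z => \sum_(t < len) dlt K ((k1, L + t%:Z) ::
    (k2, n - (L + t%:Z)) :: w) z) = \sum_(i <- s0) F i.
  rewrite /s0 big_map (_ : iota 0 len = index_iota 0 len) ?big_mkord; last first.
    by rewrite /index_iota subn0.
  by rewrite fct_sumE.
rewrite (lin_sum _ _ _ (linop_pre K g)).
have [B1 h1] := rel_bound K n w hr.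
have [B2 h2] := rel_reindex n (g :: w) (c := 0) hr (@inj_id _)
  (fun i => ltac:(exists i; lia)).
have hb : exists B0, forall B, (B0 <= B)%N ->
    Q (\sum_(i <- int_ball B) brv K [::] g (k1, i) ((k2, n - i) :: w)).
  case: g hg h2 => -[] // j _ _;
    first by exists 0%N => B _; apply: sub_sum => // i _ _; exact: sub0 hQ.
  case: k1 hr {F h1 hout} => hr;
    try by exists 0%N => B _; apply: sub_sum => // i _ _; exact: sub0 hQ.
  have [B0 h0] := rel_bracket_l j n w hr.
  by exists B0 => B /h0 /(subN hQ); rewrite -sumrN.
have hb' : exists B0, forall B, (B0 <= B)%N ->
    Q (\sum_(i <- int_ball B) brv K [:: (k1, i)] g (k2, n - i) w).
  case: g hg {h2 hb} => -[] // j _;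
    first by exists 0%N => B _; apply: sub_sum => // i _ _; exact: sub0 hQ.
  case: k2 hr {F h1 hout} => hr;
    try by exists 0%N => B _; apply: sub_sum => // i _ _; exact: sub0 hQ.
  case: k1 hr => // _.
  have [B0 h0] := rel_bracket_r j n w.
  by exists B0 => B /h0 /(subN hQ); rewrite -sumrN.
have [B3 h3] := hb; have [B4 h4] := hb'.
(* One ball large enough for the truncation and for three sums: moving [g] past both modes gives the
   relation applied to [g :: w] and two bracket sums. *)
pose B := (B1 + B2 + B3 + B4)%N.
apply: (@sub_window _ _ hQ _ (int_ball B) s0).
- exact: uniq_int_ball.
- by rewrite map_inj_uniq ?iota_uniq // => x y; lia.
- move=> i _ hi; apply/hMH/MH_pre/hout.
  have [|hL] := ltrP i L; first by left.
  right; rewrite leNgt; apply: contra hi => hi.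
  by apply/mapP; exists (absz (i - L)); rewrite ?mem_iota; lia.
- by move=> i _; rewrite mem_int_ball => hi; apply/hMH/MH_pre/h1; rewrite /B in hi; lia.
apply: (sub_eqm hQ _ (h2 B _)); last by rewrite /B; lia.
apply: (sub_eqm hQ _ (h3 B _)); last by rewrite /B; lia.
apply: (sub_eqm hQ _ (h4 B _)); last by rewrite /B; lia.
rewrite -!sumrB; apply: sub_sum => // i _ _; apply: hMH.
have := subD (subspace_MH K) (MH_commrel K [::] g (k1, i) ((k2, n - i) :: w))
   (MH_commrel K [:: (k1, i)] g (k2, n - i) w).
congr MHker; rewrite !commrelE /F pre_dlt /=; apply/funext => z; rewrite !vecE.
ring.
Qed.

End RgenStable.

Section Quotient.
Variables (M N : int) (ws : word -> Prop).
Let Q := @quo K M N ws.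

Let hQ : subspace Q := @subspace_quo K M N ws.
Let hMH u : MHker u -> Q u := @quo_MH K M N ws u.
Let hR u : Rgen u -> Q u := @quo_R K M N ws u.

Lemma quo_e i w : M <= i -> Q (dlt K ((KE, i) :: w)).
Proof. by move=> h; apply: quo_g; rewrite /gMN_gen /= h. Qed.

Lemma quo_f i w : N <= i -> Q (dlt K ((KF, i) :: w)).
Proof. by move=> h; apply: quo_g; rewrite /gMN_gen /= h. Qed.

(** Here h_i = [e_M, f_{i-M}] with i - M >= N, a bracket of two generators of g(M,N). *)
Lemma quo_h i w : M + N <= i -> Q (dlt K ((KH, i) :: w)).
Proof.
move=> h; have := hMH (MH_commrel K [::] (KE, M) (KF, i - M) w).
rewrite commrelE /= [brv _ _ _ _ _]/(dlt K ((KH, M + (i - M)) :: w)).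
rewrite (_ : M + (i - M) = i); last by ring.
move=> h1; rewrite -[dlt K _]opprK; apply: (subN hQ).
apply: (subDK hQ (v := dlt K ((KE, M) :: (KF, i - M) :: w) -
                       dlt K ((KF, i - M) :: (KE, M) :: w))).
  by apply: (subB hQ); [apply: quo_e|apply: quo_f; lia].
by rewrite addrC.
Qed.

(** In the z^{2N-2} coefficient of f(z)^2 every other term has a factor of index at least [N], which
    can be put in front. *)
Lemma quo_ff w : Q (dlt K ((KF, N - 1) :: (KF, N - 1) :: w)).
Proof.
have -> : (KF, N - 1) :: w = (KF, (N - 1) + (N - 1) - (N - 1)) :: w.
  by congr ((_, _) :: _); ring.
apply: rel_one => // i hi.
have [hN|hN] := lerP N i; first exact: quo_f.
by apply: rel_comm => //; apply: quo_f; lia.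
Qed.

(** The z^{2N-3} coefficient of f(z)^2 leaves two terms, equal because their factors commute; hence
    the division by 2. *)
Lemma quo_ff2 w : (2%:R : K) != 0 -> Q (dlt K ((KF, N - 1) :: (KF, N - 2) :: w)).
Proof.
move=> two_neq0; have h12 : (N - 1 : int) != N - 2 by lia.
have := @rel_two _ _ hQ hMH hR KF KF ((N - 1) + (N - 2)) w (N - 1) (N - 2) isT h12.
rewrite (_ : N - 1 + (N - 2) - (N - 1) = N - 2); last by ring.
rewrite (_ : N - 1 + (N - 2) - (N - 2) = N - 1); last by ring.
move=> h; have {h} : Q (dlt K ((KF, N - 1) :: (KF, N - 2) :: w) +
    dlt K ((KF, N - 2) :: (KF, N - 1) :: w)).
  apply: h => i hi1 hi2.
  have [hN|hN] := lerP N i; first exact: quo_f.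
  by apply: rel_comm => //; apply: quo_f; lia.
have /hMH := @comm_diff (KF, N - 1) (KF, N - 2) w isT.
move=> h1 h2; have := subZ hQ 2%:R^-1 (subD hQ h1 h2); congr Q.
apply/funext => x; rewrite !vecE; field.
exact: two_neq0.
Qed.

(** Multiplication by f_{N-1} as a map from W^{M',N-2}. Moving e_i past it leaves h_{i+N-1}, which
    is zero for i > M'; the hypothesis on h_{M'+N-1} covers the boundary case i = M'. *)
Lemma quo_pre_f M' ws' : (2%:R : K) != 0 -> M <= M' -> M' != -1 -> 1 <= N ->
  spans K M' (N - 2) ws' ->
  (forall w, Q (dlt K ((KH, M' + N - 1) :: w))) ->
  (forall w, ws' w -> ws ((KF, N - 1) :: w)) ->
  forall w, Q (dlt K ((KF, N - 1) :: w)).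
Proof.
move=> two_neq0 hM hM1 hN hs hh hws w; rewrite -pre_dlt.
apply: (spans_sub hQ (linop_pre K (KF, N - 1)) hs).
- by move=> u hu; apply/hMH/MH_pre.
- by move=> u hu; apply: Rgen_pre.
- move=> [k i] {}w; rewrite /gMN_gen pre_dlt /=.
  case/orP => /andP[/eqP -> hi].
    apply: (swap0H hQ hMH); first by apply: quo_e; lia.
    move=> _ _ _ /=; have [->|ne] := eqVneq i M'.
      by rewrite (_ : N - 1 + M' = M' + N - 1); [apply: hh|ring].
    by apply: quo_h; lia.
  have [->|n1] := eqVneq i (N - 1); first exact: quo_ff.
  have [->|n2] := eqVneq i (N - 2); first exact: quo_ff2.
  by apply: (swap0H hQ hMH) => //; apply: quo_f; lia.
(* As [M'] is not -1, the source kills v only for N = 1, and then f_0 v = 0. *)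
- rewrite (negPf hM1) /= pre_dlt => /eqP h.
  by apply/hMH/spanG; right; exists [::], (KF, N - 1); split => //=; lia.
- by move=> {}w hw; rewrite pre_dlt; apply/quo_ws/hws.
Qed.

(** Multiplication by h_{M+N-1} as a map from W^{M-1,N-1}. Only e_{M-1} and f_{N-1} are new
    relations; their products with h_{M+N-1} are the sole surviving terms of the z^{2M+N-2}
    coefficient of e(z)h(z) and the z^{M+2N-2} coefficient of f(z)h(z). *)
Lemma quo_pre_h ws' : 0 <= M -> 1 <= N ->
  spans K (M - 1) (N - 1) ws' ->
  (forall w, ws' w -> ws ((KH, M + N - 1) :: w)) ->
  forall w, Q (dlt K ((KH, M + N - 1) :: w)).
Proof.
move=> hM hN hs hws w; rewrite -pre_dlt.
apply: (spans_sub hQ (linop_pre K (KH, M + N - 1)) hs).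
- by move=> u hu; apply/hMH/MH_pre.
- by move=> u hu; apply: Rgen_pre.
- move=> [k i] {}w; rewrite /gMN_gen pre_dlt /=.
  case/orP => /andP[/eqP -> hi]; apply: (swap0H hQ hMH) => //.
    have [hM'|hM'] := lerP M i; first by apply: quo_e.
    have -> : i = M - 1 by lia.
    have -> : (KH, M + N - 1) = (KH, (M + M + N - 2) - (M - 1)).
      by congr (_, _); ring.
    apply: rel_one => // {hi hM'}i hi.
    have [hM'|hM'] := lerP M i; first by apply: quo_e.
    by apply: rel_comm => //; apply: quo_h; lia.
  have [hM'|hM'] := lerP N i; first by apply: quo_f.
  have -> : i = N - 1 by lia.
  have -> : (KH, M + N - 1) = (KH, (M + N + N - 2) - (N - 1)).
    by congr (_, _); ring.
  apply: rel_one => // {hi hM'}i hi.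
  have [hM'|hM'] := lerP N i; first by apply: quo_f.
  by apply: rel_comm => //; apply: quo_h; lia.
(* For M = 0 the source kills v, so h_{N-1} v has to vanish: it equals e_0 f_{N-1} v - f_{N-1} e_0
   v, and both terms are zero. *)
- case/orP => /eqP h; last by lia.
  have -> : M = 0 by lia.
  rewrite pre_dlt (_ : 0 + N - 1 = 0 + (N - 1)); last by ring.
  have /hMH := MH_commrel K [::] (KE, 0) (KF, N - 1) [::].
  rewrite commrelE /= [brv _ _ _ _ _]/(dlt K [:: (KH, 0 + (N - 1))]) => h1.
  rewrite -[dlt K _]opprK; apply: (subN hQ).
  apply: (subDK hQ (v := dlt K [:: (KE, 0); (KF, N - 1)] -
                         dlt K [:: (KF, N - 1); (KE, 0)])); last by rewrite addrC.
  apply: (subB hQ); first by apply: quo_e; lia.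
  by apply/hMH/spanG; right; exists [:: (KF, N - 1)], (KE, 0).
- by move=> {}w hw; rewrite pre_dlt; apply/quo_ws/hws.
Qed.

(** W^{M,N-1} is the quotient of W^{M,N} by the image of f_{N-1}; once that image is spanned, a
    spanning set of the quotient suffices. *)
Lemma quo_cover ws' : 1 <= N -> spans K M (N - 1) ws' ->
  (forall w, ws' w -> ws w) -> (forall w, Q (dlt K ((KF, N - 1) :: w))) ->
  spans K M N ws.
Proof.
move=> hN hs hws hf w; apply: (spans_sub hQ (linop_id K) hs) => //=.
- move=> [k i] {}w; rewrite /gMN_gen /=.
  case/orP => /andP[/eqP -> hi]; first exact: quo_e.
  have [hM'|hM'] := lerP N i; first by apply: quo_f.
  by have -> : i = N - 1; [lia|apply: hf].
- by case/orP => /eqP h; [apply: quo_v; rewrite h|lia].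
- by move=> {}w /hws; apply: quo_ws.
Qed.

End Quotient.

Section Recursion.
Hypothesis two_neq0 : (2%:R : K) != 0.
Variables (M N : int).
Hypotheses (hM : -1 <= M) (hN : 1 <= N).

Lemma spans_A (A A1 B2 : word -> Prop) :
  spans K M (N - 1) A1 -> spans K (M + 1) (N - 2) B2 ->
  (forall w, A1 w -> A w) -> (forall w, B2 w -> A ((KF, N - 1) :: w)) ->
  spans K M N A.
Proof.
move=> h1 h2 hA hB; apply: (quo_cover hN h1 hA).
apply: (quo_pre_f two_neq0 _ _ hN h2) => //; try lia.
by move=> w; apply: quo_h; lia.
Qed.

(** The words of [B] coming from [A1] span the image of h_{M+N}; modulo them the boundary term of
    [quo_pre_f] vanishes and multiplication by f_{N-1} from W^{M+1,N-2} is defined. *)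
Lemma spans_B (A1 B B1 B2 : word -> Prop) :
  spans K M (N - 1) A1 -> spans K (M + 1) (N - 2) B2 ->
  spans K (M + 1) (N - 1) B1 ->
  (forall w, A1 w -> B ((KH, M + N) :: w)) ->
  (forall w, B2 w -> B ((KF, N - 1) :: w)) -> (forall w, B1 w -> B w) ->
  spans K (M + 1) N B.
Proof.
move=> hA1 hB2 hB1 hA hB hB'; apply: (quo_cover hN hB1 hB').
apply: (quo_pre_f two_neq0 _ _ hN hB2) => //; try lia.
apply: (@quo_pre_h _ _ _ A1) => //; try lia.
- by rewrite addrK.
- by move=> w /hA; rewrite (_ : M + 1 + N - 1 = M + N) //; ring.
Qed.

End Recursion.
End Steps.

(** * Base cases of the recursion *)

Section Base.
Variable K : fieldType.
Implicit Types (u v : vec K) (w p q : word) (g x y : gen).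

(** W^{M',N'} is a quotient of W^{M,N}; the lower bounds ensure that v, if killed in the larger
    space, is killed in the smaller one. *)
Lemma spans_mono M N M' N' ws ws' : M' <= M -> N' <= N -> -1 <= M' -> -1 <= N' ->
  spans K M N ws -> (forall w, ws w -> quo M' N' ws' (dlt K w)) ->
  spans K M' N' ws'.
Proof.
move=> hM hN hM1 hN1 hs hws w; have hQ := @subspace_quo K M' N' ws'.
apply: (spans_sub hQ (linop_id K) hs) => //=.
- by move=> u; apply: quo_MH.
- by move=> u; apply: quo_R.
- move=> [k i] {}w; rewrite /gMN_gen /= => h; apply: quo_g.
  by case/orP: h => /andP[/eqP -> h]; rewrite /gMN_gen /=; lia.
- by move=> h; apply: quo_v; lia.
Qed.

(** The letter [g] moves right to the vacuum; each commutator merges it with its neighbour into one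
    letter, so what follows [p] is no longer than [w]. *)
Lemma reduce (Q : vec K -> Prop) p g w : subspace Q -> (forall u, MHker u -> Q u) ->
  g.2 <= 0 -> (forall w', (size w' <= size w)%N -> Q (dlt K (p ++ w'))) ->
  Q (dlt K (p ++ g :: w)).
Proof.
move=> hQ hMH hg; elim: w p => [|x w ih] p hw.
  by apply/hMH/spanG; right; exists p, g; rewrite cats1.
apply: (swap hQ hMH).
  rewrite -cat_rcons; apply: ih => w' hw'; rewrite cat_rcons.
  exact: hw.
have h z : Q (dlt K (p ++ z :: w)) by apply: hw.
rewrite /brv; case: g.1; case: x.1; try exact: (sub0 hQ); try exact: h.
exact: (subN hQ).
Qed.

Lemma spans_1_0 : spans K 1 0 (eq [::]).
Proof.
have hQ := @subspace_quo K 1 0 (eq [::]).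
have hMH := @quo_MH K 1 0 (eq [::]).
move=> w; elim: {w}(size w) {-2}w (leqnn (size w)) => [|n ih] [|[k i] w] //= hw;
  try exact: quo_ws.
have [hi|hi] := lerP i 0.
  by apply: (@reduce _ [::] (k, i) w hQ hMH) => // w' /= hw'; apply: ih; exact: leq_trans hw' _.
by case: k; [apply: quo_e|apply: quo_h|apply: quo_f] => //; lia.
Qed.

Lemma spans_2_0 : spans K 2 0 (fun w => w = [::] \/ w = [:: (KE, 1)]).
Proof.
set ws := fun w => _ \/ _.
have hQ := @subspace_quo K 2 0 ws.
have hMH := @quo_MH K 2 0 ws.
have hR := @quo_R K 2 0 ws.
(* Words beginning with e_1 come first, because below h_1 is rewritten as e_1 f_0 - f_0 e_1. *)
have hE w : quo 2 0 ws (dlt K ((KE, 1) :: w)).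
  elim: {w}(size w) {-2}w (leqnn (size w)) => [|n ih] [|[k i] w] //= hw;
    try by apply: quo_ws; right.
  have [hi|hi] := lerP i 0.
    by apply: (@reduce _ [:: (KE, 1)] (k, i) w hQ hMH) => // w' /= hw'; apply: ih; exact: leq_trans hw' _.
  case: k {hw}.
  - have [h2|h2] := lerP 2 i.
      by apply: (swap0H hQ hMH) => //; apply: quo_e.
    (* The shape [2 - 1] exhibits e_1 e_1 as a term of the z^2 coefficient of e(z)^2, whose other
       terms contain some e_j with j >= 2. *)
    rewrite (_ : i = 2 - 1); last by lia.
    apply: rel_one => // j hj; have [hj2|hj2] := lerP 2 j; first exact: quo_e.
    by apply: rel_comm => //; apply: quo_e; lia.
  - have [h2|h2] := lerP 2 i.
      by apply: (swap0H hQ hMH) => //; apply: quo_h.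
    rewrite (_ : i = 2 - 1); last by lia.
    apply: rel_one => // j hj; have [hj2|hj2] := lerP 2 j; first exact: quo_e.
    by apply: rel_comm => //; apply: quo_h; lia.
  - apply: (swap0H hQ hMH); first by apply: quo_f; lia.
    by move=> _ _ _; apply: quo_h => /=; lia.
move=> w; elim: {w}(size w) {-2}w (leqnn (size w)) => [|n ih] [|[k i] w] //= hw;
  try by apply: quo_ws; left.
have [hi|hi] := lerP i 0.
  by apply: (@reduce _ [::] (k, i) w hQ hMH) => // w' /= hw'; apply: ih; exact: leq_trans hw' _.
case: k {hw}.
- have [h2|h2] := lerP 2 i; first exact: quo_e.
  by have -> : i = 1 by lia.
- have [h2|h2] := lerP 2 i; first exact: quo_h.
  have -> : i = 1 + 0 by lia.
  have := hMH _ (MH_commrel K [::] (KE, 1) (KF, 0) w).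
  rewrite commrelE /= [brv _ _ _ _ _]/(dlt K ((KH, 1 + 0) :: w)) => h1.
  rewrite -[dlt K _]opprK; apply: (subN hQ).
  apply: (subDK hQ (v := dlt K [:: (KE, 1), (KF, 0) & w] -
                         dlt K [:: (KF, 0), (KE, 1) & w])); last by rewrite addrC.
  by apply: (subB hQ); [apply: hE|apply: quo_f].
- by apply: quo_f; lia.
Qed.

Lemma spans_0_0 : spans K 0 0 (eq [::]).
Proof. by apply: (spans_mono _ _ _ _ spans_1_0) => // w; apply: quo_ws. Qed.

(** The space is a quotient of W^{1,0}, which v spans, and v is zero in it; so it is zero and any
    family spans it. *)
Lemma spans_v M N ws : M == -1 \/ N == -1 -> -1 <= M <= 1 -> -1 <= N <= 0 ->
  spans K M N ws.
Proof.
move=> h hM hN; apply: (spans_mono _ _ _ _ spans_1_0); try lia.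
by move=> w <-; apply: quo_v; lia.
Qed.

Lemma spans_2_N1 : spans K 2 (-1) (eq [:: (KE, 1)]).
Proof.
apply: (spans_mono _ _ _ _ spans_2_0) => // w [->|->]; first exact: quo_v.
exact: quo_ws.
Qed.

Lemma spans_sub_ws M N (ws ws' : word -> Prop) :
  (forall w, ws w -> ws' w) -> spans K M N ws -> spans K M N ws'.
Proof.
move=> h hs w; move: (hs w); apply: spanP_mono => u [hu|[w' /h hw' ->]].
- by left.
- by right; exists w'.
Qed.

End Base.

(** * Configurations *)

Definition compat (a' b' g' : bool) (c : bool * bool) :=
  [&& (b' + a' + c.1 <= 1)%N, (b' + c.2 + c.1 <= 1)%N & c.2 ==> g'].

Definition nextg (g' : bool) (c : bool * bool) := ~~ c.2 && (c.1 || g').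

(* A configuration is read from the top column (a_n, b_n) down to (a_0, b_0);
   (a', b') is the column just above, and g' records whether the nearest nonzero
   symbol above is some a_j. *)
Fixpoint accepts (fin : bool -> bool -> bool -> bool) a' b' g' (s : seq (bool * bool)) :=
  if s is c :: s' then
    compat a' b' g' c && accepts fin c.1 c.2 (nextg g' c) s'
  else fin a' b' g'.

(** At the bottom of the scan the flag is the condition of C^{1,N} that some nonzero a_j has no b_s
    at or below it. *)
Definition fin1 (a b g : bool) := g.
Definition fin0 (a b g : bool) := ~~ a && ~~ b.

(** One reading rule for the three families tau, so that spanning is proved once; on accepted
    sequences it gives literally the same words. *)
Fixpoint col_word (M : int) (s : seq (bool * bool)) : word :=
  if s is c :: s' then
    if (M == 1) && nilp s' then opt (~~ c.1) (KE, 1)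
    else opt c.2 (KH, (size s')%:Z) ++ opt c.1 (KF, (size s')%:Z - M) ++ col_word M s'
  else [::].

Section Columns.
Variables a b : nat -> bool.

Definition columns_of m := [seq (a k, b k) | k <- rev (iota 0 m)].

Lemma columns_ofS m : columns_of m.+1 = (a m, b m) :: columns_of m.
Proof. by rewrite /columns_of -[m.+1]addn1 iotaD rev_cat. Qed.

Lemma size_columns_of m : size (columns_of m) = m.
Proof. by rewrite size_map size_rev size_iota. Qed.

Variable n : nat.
Hypothesis (ha : forall k, (n < k)%N -> a k = false).
Hypothesis (hb : forall k, (n < k)%N -> b k = false).

(** At [i.+1] this is the right neighbour condition for b_i, at 0 the additional condition of
    C^{1,N}. *)
Definition above k := `[< exists j, [/\ (k <= j)%N, a j &
  forall s, (k <= s)%N -> (s <= j)%N -> ~~ b s] >].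

Lemma aboveS k : above k = nextg (above k.+1) (a k, b k).
Proof.
rewrite /nextg /=; apply/asboolP/andP => [[j [kj aj hj]]|[bk]].
  split; first by apply: hj.
  case: (eqVneq k j) => [->|ne]; first by rewrite aj.
  apply/orP; right; apply/asboolP; exists j; split => // [|s hs]; first by lia.
  by apply: hj; lia.
case/orP => [ak|/asboolP[j [kj aj hj]]].
  exists k; split => // s h1 h2; have -> // : s = k by lia.
exists j; split => // [|s h1 h2]; first by lia.
by have [-> //|ne] := eqVneq s k; apply: hj => //; lia.
Qed.

Lemma above_top : above n.+1 = false.
Proof. by apply/asboolP => -[j [hj]]; rewrite ha. Qed.

Definition local i := compat (a i.+1) (b i.+1) (above i.+1) (a i, b i).

Lemma accepts_columns_of fin m : accepts fin (a m) (b m) (above m) (columns_of m) =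
  all local (iota 0 m) && fin (a 0%N) (b 0%N) (above 0).
Proof.
elim: m => [//|m ih]; have -> : iota 0 m.+1 = rcons (iota 0 m) m.
  by rewrite -addn1 iotaD cats1.
by rewrite all_rcons columns_ofS [LHS]/= -aboveS ih andbA.
Qed.

Lemma accepts_cols fin : accepts fin false false false (columns_of n.+1) =
  all local (iota 0 n.+1) && fin (a 0%N) (b 0%N) (above 0).
Proof. by rewrite -accepts_columns_of ha ?hb ?above_top. Qed.

Lemma local_ab i : local i -> ~~ (a i && b i).
Proof. by case/and3P => /= _; case: (a i); case: (b i); case: (b i.+1). Qed.

Definition tau0_word m : word := flatten [seq opt (a k) (KF, k%:Z) ++ opt (b k) (KH, k%:Z)
  | k <- rev (iota 1 m)].
Definition tau1_word m : word := flatten [seq opt (b k) (KH, k%:Z) ++ opt (a k) (KF, (k.-1)%:Z)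
  | k <- rev (iota 1 m)] ++ opt (~~ a 0) (KE, 1).
Definition taum_word m : word := opt (a m) (KF, (m.+1)%:Z) ++
  flatten [seq opt (a k.-1) (KF, k%:Z) ++ opt (b k) (KH, k%:Z) | k <- rev (iota 1 m)].

Lemma rev_iotaS m : rev (iota 1 m.+1) = m.+1 :: rev (iota 1 m).
Proof. by rewrite -[m.+1 in LHS]addn1 iotaD rev_cat add1n. Qed.

Lemma col_word_tau1 m : col_word 1 (columns_of m.+1) = tau1_word m.
Proof.
elim: m => [//|m ih]; rewrite columns_ofS /col_word -/col_word.
rewrite {1}columns_ofS ih /tau1_word rev_iotaS /=.
rewrite size_columns_of /= -!catA; congr (_ ++ _); congr (opt _ (_, _) ++ _).
lia.
Qed.

(** The two words order f_k and h_k differently, but a_k and b_k are never both 1. *)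
Lemma col_word_tau0 m : (forall i, (i <= m)%N -> local i) -> ~~ a 0 -> ~~ b 0 ->
  col_word 0 (columns_of m.+1) = tau0_word m.
Proof.
move=> hl a0 b0; elim: m hl => [|m ih] hl.
  by rewrite columns_ofS /= (negPf a0) (negPf b0).
rewrite columns_ofS /col_word -/col_word ih; last by move=> i hi; apply: hl; lia.
rewrite [(_ == _) && _]/= /tau0_word rev_iotaS /= size_columns_of -catA subr0.
by have := local_ab (hl m.+1 (leqnn _)); case: (a m.+1); case: (b m.+1).
Qed.

(** If b_k = 1, the triangle relations give a_k = a_{k-1} = 0, so the different place of h_k does
    not change the word. *)
Lemma col_word_taum m : (forall i, (i <= m)%N -> local i) -> ~~ b 0 ->
  col_word (-1) (columns_of m.+1) = taum_word m.
Proof.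
move=> hl b0; elim: m hl => [|m ih] hl.
  by rewrite columns_ofS /= (negPf b0) /taum_word /= opprK.
rewrite columns_ofS /col_word -/col_word ih; last by move=> i hi; apply: hl; lia.
rewrite [(_ == _) && _]/= /taum_word rev_iotaS /= size_columns_of -!catA opprK.
rewrite (_ : m.+1%:Z + 1 = m.+2%:Z); last by lia.
have /and3P[] := hl m (leqnSn _); have := local_ab (hl m.+1 (leqnn _)) => /=.
by case: (a m.+1); case: (b m.+1); case: (a m) => //=; case: (b m).
Qed.

End Columns.

Section Configurations.
Variable n : nat.
Implicit Types (x : seqs n) (s : seq (bool * bool)).

Definition cols x := columns_of (rd x.1) (rd x.2) n.+1.
Definition uncols s : seqs n :=
  ([ffun i : 'I_n.+1 => (nth (false, false) s (n - i)).1],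
   [ffun i : 'I_n.+1 => (nth (false, false) s (n - i)).2]).

Lemma nth_cols x i : (i <= n)%N ->
  nth (false, false) (cols x) (n - i) = (rd x.1 i, rd x.2 i).
Proof.
move=> hi; rewrite /cols /columns_of (nth_map 0%N) ?size_rev ?size_iota; last by lia.
rewrite nth_rev ?size_iota ?nth_iota; try lia.
by rewrite add0n (_ : (n.+1 - (n - i).+1 = i)%N) //; lia.
Qed.

Lemma rd_ord (f : {ffun 'I_n.+1 -> bool}) (i : 'I_n.+1) : rd f i = f i.
Proof. by rewrite /rd -ltnS ltn_ord inord_val. Qed.

Lemma colsK : cancel cols uncols.
Proof.
move=> x; rewrite /uncols [RHS]surjective_pairing; congr (_, _); apply/ffunP => i;
  by rewrite ffunE nth_cols ?rd_ord // -ltnS.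
Qed.

Lemma uncolsK s : size s = n.+1 -> cols (uncols s) = s.
Proof.
move=> hs; apply: (@eq_from_nth _ (false, false)); first by rewrite size_columns_of.
move=> i; rewrite size_columns_of => hi; have -> : i = (n - (n - i))%N by lia.
rewrite nth_cols ?leq_subr // /rd leq_subr /= !ffunE inordK; last by lia.
by rewrite -surjective_pairing.
Qed.

Lemma rd_out (f : {ffun 'I_n.+1 -> bool}) k : (n < k)%N -> rd f k = false.
Proof. by move=> h; rewrite /rd leqNgt h. Qed.

Lemma aboveP x k :
  [exists j : 'I_n.+1, ((k <= j)%N && rd x.1 j) &&
     [forall s : 'I_n.+1, ((k <= s)%N && (s <= j)%N) ==> ~~ rd x.2 s]]
  = above (rd x.1) (rd x.2) k.
Proof.
apply/existsP/asboolP => [[j /andP[/andP[kj aj] /forallP hj]]|[j [kj aj hj]]].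
  exists j; split => // s ks sj.
  have hs : (s < n.+1)%N by apply: leq_ltn_trans sj _.
  by have /implyP := hj (Ordinal hs); apply; rewrite ks.
have hn : (j < n.+1)%N by rewrite ltnNge; apply: contraL aj => h; rewrite rd_out.
exists (Ordinal hn); rewrite kj aj /=; apply/forallP => s; apply/implyP => /andP[].
exact: hj.
Qed.

Lemma local_triangle x :
  all (local (rd x.1) (rd x.2)) (iota 0 n.+1) = triangle x && rightnb x.
Proof.
apply/allP/andP => [h|[/forallP ht /forallP hr] i].
  have {}h (i : 'I_n.+1) : local (rd x.1) (rd x.2) i.
    by apply: h; rewrite mem_iota ltn_ord.
  split; apply/forallP => i; have /and3P[h1 h2 h3] := h i.
    by rewrite h1.
  by move: h3; rewrite /= -aboveP.
rewrite mem_iota /= add0n => hi.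
have /andP[h1 h2] := ht (Ordinal hi); have h3 := hr (Ordinal hi).
by rewrite /local /compat h1 h2 /= -aboveP.
Qed.

Lemma mem_C1 x : (x \in C1 n) = accepts fin1 false false false (cols x).
Proof.
rewrite inE accepts_cols; try exact: rd_out.
rewrite local_triangle /fin1 -aboveP /baseC.
have -> : [exists j : 'I_n.+1, rd x.1 j && [forall s : 'I_n.+1, (s <= j)%N ==> ~~ rd x.2 s]]
  = [exists j : 'I_n.+1, ((0 <= j)%N && rd x.1 j) &&
     [forall s : 'I_n.+1, ((0 <= s)%N && (s <= j)%N) ==> ~~ rd x.2 s]] by [].
case: existsP => [[j /andP[_ /forallP /(_ ord0)]]|_]; last by rewrite !andbF.
by rewrite rd_ord /= => ->; rewrite !andbT.
Qed.

Lemma mem_C0 x : (x \in C0 n) = accepts fin0 false false false (cols x).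
Proof.
rewrite inE accepts_cols; try exact: rd_out.
rewrite local_triangle /fin0 /baseC -(rd_ord x.2 ord0) /=.
by case: (rd x.1 _); case: (rd x.2 _); rewrite /= ?andbF ?andbT.
Qed.

End Configurations.

(** * Counting accepted sequences *)

Section Count.
Variable fin : bool -> bool -> bool -> bool.

Definition columns := [:: (false, false); (true, false); (false, true); (true, true)].

Fixpoint acc_seqs L a b g : seq (seq (bool * bool)) :=
  if L is L'.+1 then
    [seq c :: s | c <- filter (compat a b g) columns, s <- acc_seqs L' c.1 c.2 (nextg g c)]
  else if fin a b g then [:: [::]] else [::].

Lemma mem_acc_seqs L a b g s : (s \in acc_seqs L a b g) = (size s == L) && accepts fin a b g s.
Proof.
elim: L a b g s => [|L ih] a b g s.
  by rewrite /=; case: ifP; case: s => [|c s] //= ->; rewrite inE.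
apply/allpairsPdep/andP => [[c [s' []]]|].
  by rewrite mem_filter ih => /andP[hc _] /andP[/eqP <- hs] -> /=; rewrite hc.
case: s => [[]//|c s] [hs /andP[hc ha]]; exists c, s.
split=> //; last by rewrite ih; apply/andP.
by rewrite mem_filter hc; case: c {hs hc ha} => [[] []].
Qed.

Lemma uniq_acc_seqs L a b g : uniq (acc_seqs L a b g).
Proof.
elim: L a b g => [|L ih] a b g; first by rewrite /=; case: ifP.
apply: allpairs_uniq_dep.
- exact: filter_uniq.
- by move=> c _; apply: ih.
- by move=> [c s] [c' s'] _ _ /= [-> ->].
Qed.

(** Transfer matrix on the four reachable states: A (start), F (below an [a]), B (below an empty
    column, flag set), H (below a [b]). The counts obey A' = A + F, F' = B + H, B' = B + F + H, H' =
    A; only the sum B + H is tracked, since B and H separately need not be powers of 2. *)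
Lemma size_acc_seqs L : fin false false true -> fin false true false = false ->
  fin true false true = ~~ fin false false false ->
  [/\ size (acc_seqs L.+1 false false false) = (2 ^ L)%N,
      size (acc_seqs L.+1 true false true) = (2 ^ L)%N &
      (size (acc_seqs L.+1 false false true) +
       size (acc_seqs L.+1 false true false) = 2 ^ L.+1)%N].
Proof.
move=> hB hH hF.
have eA m : (size (acc_seqs m.+1 false false false) =
    size (acc_seqs m false false false) + size (acc_seqs m true false true))%N.
  by rewrite size_allpairs_dep /= addn0.
have eF m : (size (acc_seqs m.+1 true false true) =
    size (acc_seqs m false false true) + size (acc_seqs m false true false))%N.
  by rewrite size_allpairs_dep /= addn0.
have eB m : (size (acc_seqs m.+1 false false true) = size (acc_seqs m false false true) +
    (size (acc_seqs m true false true) + size (acc_seqs m false true false)))%N.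
  by rewrite size_allpairs_dep /= addn0.
have eH m : (size (acc_seqs m.+1 false true false) = size (acc_seqs m false false false))%N.
  by rewrite size_allpairs_dep /= addn0.
elim: L => [|L [h1 h2 h3]].
  by rewrite (eA 0%N) (eF 0%N) (eB 0%N) (eH 0%N) /= hB hH hF; case: (fin _ _ _).
rewrite (eA L.+1) (eF L.+1) (eB L.+1) (eH L.+1) h1 h2 !expnS in h3 *.
by split; lia.
Qed.

End Count.

(** * The fermionic model *)

(** The first component is the row: [Some true], [None], [Some false] for rows one, two, three. *)
Definition site := (option bool * int)%type.
Definition conf := site -> bool.

Definition upd (m : conf) (a : site) (v : bool) : conf :=
  fun b => if b == a then v else m b.

Lemma updC m a b v v' : a != b -> upd (upd m a v) b v' = upd (upd m b v') a v.
Proof.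
move=> ab; apply/funext => c; rewrite /upd.
by case: (eqVneq c b) => [->|//]; rewrite eq_sym (negPf ab).
Qed.

Lemma updd m a v v' : upd (upd m a v) a v' = upd m a v'.
Proof. by apply/funext => c; rewrite /upd; case: eqP. Qed.

Lemma upd_id m a : upd m a (m a) = m.
Proof. by apply/funext => c; rewrite /upd; case: eqP => [->|]. Qed.

Lemma upd_eq m a v : upd m a v a = v. Proof. by rewrite /upd eqxx. Qed.

Lemma upd_ne m a b v : b != a -> upd m a v b = m b.
Proof. by rewrite /upd => /negPf ->. Qed.

(* In the first and second rows [true] means occupied, in the third row it
   means vacant: [T] is a set of holes. *)
Definition sea (S : pred int) (d : int) (T : pred int) : conf :=
  fun s => match s.1 with
           | Some true => S s.2 | None => s.2 <= d | Some false => T s.2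
           end.

Section Fermions.
Variable K : fieldType.
Definition fock := conf -> K.
Implicit Types (F G : fock) (m : conf) (a b : site) (v : bool).

Definition sg a m : K :=
  (-1) ^+ (\sum_(j < pickle a) oapp m false (pickle_inv j))%N.

Lemma sg_sqr a m : sg a m * sg a m = 1.
Proof. by rewrite /sg -expr2 sqrr_sign. Qed.

Lemma sg_neq0 a m : sg a m != 0.
Proof. by rewrite /sg signr_eq0. Qed.

Lemma sg_upd a b v m : m b = ~~ v ->
  sg a (upd m b v) = if (pickle b < pickle a)%N then - sg a m else sg a m.
Proof.
move=> mb; have hne (j : nat) : j != pickle b ->
    oapp (upd m b v) false (pickle_inv j) = oapp m false (pickle_inv j).
  move=> hj; have := @pickle_invK site j; case: (pickle_inv j) => //= t ht.
  by rewrite upd_ne //; apply: contra hj => /eqP <-; apply/eqP.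
case: ltnP => h; last first.
  congr (_ ^+ _); apply: eq_bigr => j _; rewrite hne //.
  by rewrite neq_ltn (leq_trans (ltn_ord j) h).
rewrite /sg (bigD1 (Ordinal h)) //= [in RHS](bigD1 (Ordinal h)) //= pickleK_inv /=.
rewrite upd_eq mb !exprD -mulNr; congr (_ * _); last first.
  by congr (_ ^+ _); apply: eq_bigr => j hj; rewrite hne.
by case: v {mb hne}; rewrite ?expr0 ?expr1 ?opprK.
Qed.

(* Creation ([v = true]) and annihilation ([v = false]) of a fermion at [a].
   The Jordan-Wigner sign counts the fermions preceding [a] in the enumeration
   [pickle] of the sites, which is finite even for infinite configurations. *)
Definition op v a F : fock :=
  fun m => if m a == v then sg a m * F (upd m a (~~ v)) else 0.

Lemma fock0E m : (0 : fock) m = 0. Proof. by []. Qed.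
Lemma fockDE F G m : (F + G) m = F m + G m. Proof. by []. Qed.
Lemma fockNE F m : (- F) m = - F m. Proof. by []. Qed.
Definition fockE := (fock0E, fockDE, fockNE).

Lemma fock_sumE (I : Type) (r : seq I) (P : pred I) (f : I -> fock) m :
  (\sum_(i <- r | P i) f i) m = \sum_(i <- r | P i) f i m.
Proof. by rewrite (@fct_sumE I conf K). Qed.

Lemma op0 v a : op v a 0 = 0.
Proof. by apply/funext => m; rewrite /op fockE mulr0 if_same. Qed.

Lemma opD v a F G : op v a (F + G) = op v a F + op v a G.
Proof.
by apply/funext => m; rewrite fockE /op; case: ifP; rewrite ?fockE ?mulrDr ?addr0.
Qed.

Lemma op_anti v v' a b F : (a != b) || (v == v') ->
  op v a (op v' b F) = - op v' b (op v a F).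
Proof.
move=> h; apply/funext => m; rewrite fockE /op.
have [eab|ab] := eqVneq a b.
  move: h; rewrite eab eqxx /= => /eqP ->; rewrite upd_eq.
  by case: v'; rewrite /= mulr0 if_same oppr0.
rewrite upd_ne 1?eq_sym // upd_ne //.
case: (eqVneq (m a) v) => ma; case: (eqVneq (m b) v') => mb;
  rewrite ?mulr0 ?oppr0 //.
rewrite (updC _ _ _ ab) !sg_upd ?negbK //.
have : pickle a != pickle b by rewrite (inj_eq (pcan_inj pickleK)).
by rewrite neq_ltn => /orP[h1|h1]; rewrite h1 ltnNge ltnW //=; ring.
Qed.

Lemma op_car v a F : op v a (op (~~ v) a F) + op (~~ v) a (op v a F) = F.
Proof.
apply/funext => m; rewrite fockE /op !upd_eq !eqxx negbK !updd /=.
have hm : m a = v -> upd m a v = m by move=> <-; apply: upd_id.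
have hm' : m a = ~~ v -> upd m a (~~ v) = m by move=> <-; apply: upd_id.
case: (eqVneq (m a) v) => ma.
  rewrite hm // sg_upd ?negbK // ltnn mulrA sg_sqr mul1r.
  by rewrite ma; case: (v); rewrite addr0.
have {}ma : m a = ~~ v by move: ma; case: (m a); case: (v).
by rewrite ma !eqxx hm' // sg_upd // ltnn mulrA sg_sqr mul1r add0r.
Qed.

Variable P : nat.

(* [TC1], [TC2] create in the first and second row, [TD2] annihilates in the
   second row and [TD3] creates a hole in the third one. *)
Inductive tag := TC1 | TC2 | TD2 | TD3.
Definition line t := match t with TC1 => Some true | TD3 => Some false | _ => None end.
Definition sgn t := if t is TD2 then false else true.
Definition inrange t (k : int) :=
  match t with TC1 => (1 <= k) && (k <= P%:Z)
             | TD3 => (- P%:Z < k) && (k <= 0) | _ => true end.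

Definition fop t (k : int) F : fock :=
  if inrange t k then op (sgn t) (line t, k) F else 0.

Lemma fop0 t k : fop t k 0 = 0.
Proof. by rewrite /fop op0 if_same. Qed.

Lemma fopD t k F G : fop t k (F + G) = fop t k F + fop t k G.
Proof. by rewrite /fop; case: ifP => _; rewrite ?opD ?addr0. Qed.

Lemma fopN t k F : fop t k (- F) = - fop t k F.
Proof. by apply/eqP; rewrite -addr_eq0 -fopD addNr fop0. Qed.

Lemma fop_sum t k (I : Type) (r : seq I) (Q : pred I) (f : I -> fock) :
  fop t k (\sum_(i <- r | Q i) f i) = \sum_(i <- r | Q i) fop t k (f i).
Proof. by apply: big_morph; [apply: fopD|apply: fop0]. Qed.

Lemma fop_out t k F : ~~ inrange t k -> fop t k F = 0.
Proof. by rewrite /fop => /negPf ->. Qed.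

Definition indep t (k : int) t' (k' : int) :=
  [|| line t != line t', sgn t == sgn t' | k != k'].

Lemma fop_anti t k t' k' F : indep t k t' k' ->
  fop t k (fop t' k' F) = - fop t' k' (fop t k F).
Proof.
move=> h; rewrite /fop; case: ifP => _; case: ifP => _;
  rewrite ?op0 ?oppr0 // op_anti //.
by move: h; rewrite /indep xpair_eqE negb_and -orbA [(k != k') || _]orbC.
Qed.

Lemma fop_car k l F : fop TC2 k (fop TD2 l F) + fop TD2 l (fop TC2 k F) =
  if k == l then F else 0.
Proof.
case: eqVneq => [->|kl]; first exact: (@op_car true).
by rewrite (@fop_anti TC2 k TD2) ?addNr // /indep kl.
Qed.

Lemma fop_quad t1 k1 t2 k2 t3 k3 t4 k4 F :
  indep t1 k1 t3 k3 -> indep t1 k1 t4 k4 -> indep t2 k2 t3 k3 -> indep t2 k2 t4 k4 ->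
  fop t1 k1 (fop t2 k2 (fop t3 k3 (fop t4 k4 F))) =
  fop t3 k3 (fop t4 k4 (fop t1 k1 (fop t2 k2 F))).
Proof.
move=> h13 h14 h23 h24.
rewrite (fop_anti (fop t4 k4 F) h23) fopN (fop_anti _ h13) opprK.
by rewrite (fop_anti F h24) !fopN (fop_anti _ h14) !fopN opprK.
Qed.

Definition sites1 : seq int := [seq (t.+1)%:Z | t <- iota 0 P].
Definition sites3 : seq int := [seq - t%:Z | t <- iota 0 P].

Lemma uniq_sites1 : uniq sites1.
Proof. by rewrite map_inj_uniq ?iota_uniq // => x y; lia. Qed.
Lemma uniq_sites3 : uniq sites3.
Proof. by rewrite map_inj_uniq ?iota_uniq // => x y; lia. Qed.

Lemma mem_sites1 k : (k \in sites1) = inrange TC1 k.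
Proof.
apply/mapP/idP => [[t]|/= h]; first by rewrite mem_iota /=; lia.
by exists (absz (k - 1)); rewrite ?mem_iota; lia.
Qed.

Lemma mem_sites3 k : (k \in sites3) = inrange TD3 k.
Proof.
apply/mapP/idP => [[t]|/= h]; first by rewrite mem_iota /=; lia.
by exists (absz k); rewrite ?mem_iota; lia.
Qed.

(** Cutting rows one and three off at [P] makes each operator a finite sum. The brackets survive,
    because the only contraction, between e and f, takes place in the second row. *)
Definition gop (g : gen) F : fock :=
  match g.1 with
  | KE => \sum_(p <- sites1) fop TC1 p (fop TD2 (p - g.2) F)
  | KH => \sum_(p <- sites1) fop TC1 p (fop TD3 (p - g.2) F)
  | KF => \sum_(q <- sites3) fop TC2 (q + g.2) (fop TD3 q F)
  end.

Lemma gop0 g : gop g 0 = 0.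
Proof. by case: g => -[] i; rewrite /gop /= big1 // => p _; rewrite !fop0. Qed.

Lemma gopD g F G : gop g (F + G) = gop g F + gop g G.
Proof.
by case: g => -[] i; rewrite /gop /= -big_split; apply: eq_bigr => p _; rewrite !fopD.
Qed.

Lemma gopN g F : gop g (- F) = - gop g F.
Proof. by apply/eqP; rewrite -addr_eq0 -gopD addNr gop0. Qed.

Lemma sum_window (V : zmodType) (f : int -> V) (s1 s2 : seq int) :
  uniq s1 -> uniq s2 -> (forall i, i \in s1 -> i \notin s2 -> f i = 0) ->
  (forall i, i \in s2 -> i \notin s1 -> f i = 0) ->
  \sum_(i <- s1) f i = \sum_(i <- s2) f i.
Proof.
move=> u1 u2 h1 h2.
rewrite (bigID (mem s2)) /= [RHS](bigID (mem s1)) /=.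
rewrite [X in _ + X]big_seq_cond [X in _ = _ + X]big_seq_cond.
rewrite [X in _ + X]big1; last by move=> i /andP[]; apply: h1.
rewrite [X in _ = _ + X]big1; last by move=> i /andP[]; apply: h2.
rewrite !addr0 -[LHS]big_filter -[RHS]big_filter; apply: perm_big.
apply: uniq_perm; rewrite ?filter_uniq // => i.
by rewrite !mem_filter andbC.
Qed.

(** Summing over holes gives h the shape of f, as needed for f(z)h(z). *)
Lemma gopH i F : gop (KH, i) F = \sum_(q <- sites3) fop TC1 (q + i) (fop TD3 q F).
Proof.
pose f p := fop TC1 p (fop TD3 (p - i) F).
have -> : \sum_(q <- sites3) fop TC1 (q + i) (fop TD3 q F) =
    \sum_(p <- [seq q + i | q <- sites3]) f p.
  by rewrite [RHS]big_map; apply: eq_bigr => q _; rewrite /f addrK.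
apply: sum_window => [||p _ hp|p _ hp].
- exact: uniq_sites1.
- by rewrite map_inj_uniq ?uniq_sites3 //; apply: addIr.
- rewrite /f [fop TD3 _ _]fop_out ?fop0 // -mem_sites3; apply: contra hp => hp.
  by rewrite -(subrK i p); apply: map_f.
- by rewrite /f fop_out // -mem_sites1.
Qed.

Lemma gop_EF i j F : gop (KE, i) (gop (KF, j) F) - gop (KF, j) (gop (KE, i) F) =
  gop (KH, i + j) F.
Proof.
rewrite /gop /=.
transitivity (\sum_(p <- sites1) \sum_(q <- sites3)
    fop TC1 p (if q + j == p - i then fop TD3 q F else 0)).
  under eq_bigr => p _ do rewrite !fop_sum.
  under [X in _ - X]eq_bigr => q _ do rewrite !fop_sum.
  rewrite [X in _ - X]exchange_big -sumrB; apply: eq_bigr => p _.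
  rewrite -sumrB; apply: eq_bigr => q _.
  (* The indicator of [q + j == p - i] is expanded as the anticommutator of [TC2] and [TD2]; the
     outer operators then anticommute into place. *)
  rewrite -fop_car fopD addrC; congr (_ + _).
  rewrite (@fop_anti TD3 q TC1) // fopN (@fop_anti TC2 _ TC1) // opprK.
  by rewrite -fopN; congr fop; rewrite -fopN; congr fop; rewrite -fop_anti.
apply: eq_bigr => p _; rewrite -fop_sum; congr fop.
have [hp|hp] := boolP (p - (i + j) \in sites3); last first.
  rewrite [RHS]fop_out -?mem_sites3 // big_seq big1 // => q hq.
  by case: eqP => // h; case/negP: hp; rewrite (_ : p - (i + j) = q) //; lia.
rewrite (bigD1_seq _ hp uniq_sites3) /= big1 => [|q hq].
  by rewrite (_ : _ + j = p - i) ?eqxx ?addr0 //; ring.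
by rewrite ifN //; apply: contra hq => /eqP h; apply/eqP; lia.
Qed.

Lemma gop_comm x y F : ~~ [&& x.1 != y.1, x.1 != KH & y.1 != KH] ->
  gop x (gop y F) = gop y (gop x F).
Proof.
have gen t1 t2 t3 t4 (f1 f2 f3 f4 : int -> int) s s' :
    (forall k l, indep t1 k t3 l) -> (forall k l, indep t1 k t4 l) ->
    (forall k l, indep t2 k t3 l) -> (forall k l, indep t2 k t4 l) ->
    \sum_(p <- s) fop t1 (f1 p) (fop t2 (f2 p)
       (\sum_(q <- s') fop t3 (f3 q) (fop t4 (f4 q) F))) =
    \sum_(q <- s') fop t3 (f3 q) (fop t4 (f4 q)
       (\sum_(p <- s) fop t1 (f1 p) (fop t2 (f2 p) F))).
  move=> h13 h14 h23 h24; under eq_bigr => p _ do rewrite !fop_sum.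
  under [RHS]eq_bigr => q _ do rewrite !fop_sum.
  rewrite exchange_big; apply: eq_bigr => q _; apply: eq_bigr => p _.
  exact: fop_quad.
case: x => -[] i; case: y => -[] j //= _; try by apply: gen.
Qed.

Definition v0 : fock := fun m => `[< m = sea pred0 0 pred0 >]%:R.

Lemma op_v0 v a : sea pred0 0 pred0 a = v -> op v a v0 = 0.
Proof.
move=> h; apply/funext => m; rewrite /op /v0 fockE; case: ifP => // _.
rewrite asboolF ?mulr0 // => /(congr1 (fun c => c a)).
by rewrite upd_eq h; case: v {h}.
Qed.

Lemma fop_v0 t k : (t = TC2 /\ k <= 0) \/ (t = TD2 /\ 0 < k) -> fop t k v0 = 0.
Proof.
by case=> -[-> hk]; rewrite /fop /= op_v0 // /sea /=; lia.
Qed.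

(** For such an index, e would empty a vacant positive site of the second row, f would fill an
    occupied one, and h would need a hole out of range. *)
Lemma gop_v0 g : g.2 <= 0 -> gop g v0 = 0.
Proof.
case: g => -[] i /= hi; rewrite /gop /= big_seq big1 // => p.
- by rewrite mem_sites1 => /= hp; rewrite (@fop_v0 TD2) ?fop0 //; right; split=> //; lia.
- by rewrite mem_sites1 => /= hp; rewrite [fop TD3 _ _]fop_out ?fop0 //=; lia.
- rewrite mem_sites3 => /= hp; rewrite (@fop_anti TC2 _ TD3) //.
  by rewrite (@fop_v0 TC2) ?fop0 ?oppr0 //; left; split=> //; lia.
Qed.

Definition rhop (p : word) F : fock := foldr gop F p.
Definition rho w := rhop w v0.

Lemma rhop0 p : rhop p 0 = 0.
Proof. by elim: p => //= g p ->; rewrite gop0. Qed.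

Lemma rhopD p F G : rhop p (F + G) = rhop p F + rhop p G.
Proof. by elim: p => //= g p ->; rewrite gopD. Qed.

Lemma rhopN p F : rhop p (- F) = - rhop p F.
Proof. by elim: p => //= g p ->; rewrite gopN. Qed.

Lemma rho_cat p w : rho (p ++ w) = rhop p (rho w).
Proof. by rewrite /rho /rhop foldr_cat. Qed.

Lemma rho_nil_sea : rho [::] (sea pred0 0 pred0) = 1.
Proof. by rewrite /rho /= /v0 asboolT. Qed.

(** A functional on words does not extend to the functions of infinite support in [vec], so
    membership in its kernel is witnessed by a finite expansion. *)
Definition null (phi : word -> K) u := exists s : seq (K * word),
  u = \sum_(cw <- s) (fun x => cw.1 * dlt K cw.2 x) /\ \sum_(cw <- s) cw.1 * phi cw.2 = 0.

Lemma subspace_null phi : subspace (null phi).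
Proof.
split.
- by exists [::]; rewrite !big_nil.
- move=> _ _ [s [-> hs]] [t [-> ht]]; exists (s ++ t).
  by rewrite !big_cat /= hs ht addr0.
- move=> c _ [s [-> hs]]; exists [seq (c * cw.1, cw.2) | cw <- s].
  rewrite !big_map /=; split.
    rewrite (@fct_sumE _ _ K) [RHS](@fct_sumE _ _ K); apply/funext => x.
    by rewrite mulr_sumr; apply: eq_bigr => i _; rewrite mulrA.
  under eq_bigr => i _ do rewrite -mulrA.
  by rewrite -mulr_sumr hs mulr0.
Qed.

Lemma null_dlt phi w : phi w = 0 -> null phi (dlt K w).
Proof.
move=> h; exists [:: (1, w)]; rewrite !big_seq1 /= mul1r; split => //.
by apply/funext => x; rewrite mul1r.
Qed.

(** The value is independent of the expansion: over a common list of words, the coefficient of each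
    word is determined by the vector. *)
Lemma null_sum phi (s : seq (K * word)) :
  null phi (\sum_(cw <- s) (fun x => cw.1 * dlt K cw.2 x)) ->
  \sum_(cw <- s) cw.1 * phi cw.2 = 0.
Proof.
have key (t : seq (K * word)) r : uniq r -> {subset map snd t <= r} ->
    \sum_(cw <- t) cw.1 * phi cw.2 =
    \sum_(x <- r) (\sum_(cw <- t) (fun x => cw.1 * dlt K cw.2 x) : vec K) x * phi x.
  move=> ur hr; rewrite (@fct_sumE _ _ K).
  under [RHS]eq_bigr => x _ do rewrite mulr_suml.
  rewrite exchange_big /=; apply: eq_big_seq => -[c w] hw /=.
  have wr : w \in r by apply/hr/mapP; exists (c, w).
  rewrite (bigD1_seq w wr ur) /= /dlt eqxx mulr1 big1 ?addr0 // => x xw.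
  by rewrite (negPf xw) mulr0 mul0r.
case=> t [e ht].
pose r := undup (map snd s ++ map snd t).
rewrite (key s r) ?undup_uniq //; last by move=> x hx; rewrite mem_undup mem_cat hx.
rewrite e -(key t r) ?undup_uniq //.
by move=> x hx; rewrite mem_undup mem_cat hx orbT.
Qed.

Lemma null_dltE phi w : null phi (dlt K w) -> phi w = 0.
Proof.
move=> h; have := @null_sum phi [:: (1, w)]; rewrite !big_seq1 /= mul1r; apply.
by congr null: h; apply/funext => x; rewrite mul1r.
Qed.

Lemma MH_null m u : MHker u -> null (fun w => rho w m) u.
Proof.
have hN := @subspace_null (fun w => rho w m).
have hEF p i j q : null (fun w => rho w m) (commrel K p (KE, i) (KF, j) q).
  exists [:: (1, p ++ (KE, i) :: (KF, j) :: q); (-1, p ++ (KF, j) :: (KE, i) :: q);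
    (-1, p ++ (KH, i + j) :: q)].
  rewrite !big_cons !big_nil /= !addr0; split.
    by apply/funext => x; rewrite commrelE !vecE /brv /=; ring.
  rewrite !rho_cat /rho /= -gop_EF !(rhopD, rhopN) !fockE; ring.
have hC p x y q : ~~ [&& x.1 != y.1, x.1 != KH & y.1 != KH] ->
    null (fun w => rho w m) (commrel K p x y q).
  move=> h; exists [:: (1, p ++ x :: y :: q); (-1, p ++ y :: x :: q)].
  rewrite !big_cons !big_nil /= !addr0; split.
    rewrite commrelE (_ : brv _ _ _ _ _ = 0) ?subr0.
      by apply/funext => z; rewrite !vecE; ring.
    by move: h; rewrite /brv; case: x.1; case: y.1.
  by rewrite !rho_cat /rho /= gop_comm //; ring.
move: u; apply: spanP_min => [|u]; first exact: subspace_null.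
case=> [[p [x [y [q ->]]]]|[p [x [hx ->]]]]; last first.
  by apply: null_dlt; rewrite -cats1 rho_cat /rho /= gop_v0 ?rhop0.
case: x => -[] i; case: y => -[] j; try exact: hC; try exact: hEF.
rewrite (_ : commrel _ _ _ _ _ = - commrel K p (KE, j) (KF, i) q).
  exact: subN hN _ (hEF _ _ _ _).
apply/funext => z; rewrite !commrelE !vecE /brv /= [j + i]addrC.
ring.
Qed.

Lemma MH_rho w : MHker (dlt K w) -> rho w = 0.
Proof.
by move=> h; apply/funext => m; rewrite (null_dltE (MH_null m h)).
Qed.

(** The sign [s] selects the end of the row at which [F] is annihilated. *)
Definition vanish t s F := exists B : nat, forall k : int, B%:Z < s * k -> fop t k F = 0.

Lemma vanish_D2 w : vanish TD2 1 (rho w).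
Proof.
elim: w => [|[k i] w [B hB]].
  by exists 0%N => k hk; apply: fop_v0; right; split=> //; lia.
exists (B + `|i|)%N => l hl; have hl' : B%:Z < 1 * l by lia.
rewrite /rho /= -/(rho w) /gop; case: k => /=;
  rewrite fop_sum big_seq big1 // => p hp.
- by rewrite (@fop_anti TD2 _ TC1) // (@fop_anti TD2 _ TD2) // hB // fop0 oppr0 fop0 oppr0.
- by rewrite (@fop_anti TD2 _ TC1) // (@fop_anti TD2 _ TD3) // hB // fop0 oppr0 fop0 oppr0.
- move: hp; rewrite mem_sites3 /= => hp.
  rewrite (@fop_anti TD2 _ TC2); last by rewrite /indep /=; lia.
  by rewrite (@fop_anti TD2 _ TD3) // hB // fop0 oppr0 fop0 oppr0.
Qed.

Lemma vanish_C2 w : vanish TC2 (-1) (rho w).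
Proof.
elim: w => [|[k i] w [B hB]].
  by exists 0%N => k hk; apply: fop_v0; left; split=> //; lia.
exists (B + `|i|)%N => l hl; have hl' : B%:Z < -1 * l by lia.
rewrite /rho /= -/(rho w) /gop; case: k => /=;
  rewrite fop_sum big_seq big1 // => p hp.
- move: hp; rewrite mem_sites1 /= => hp.
  rewrite (@fop_anti TC2 _ TC1) // (@fop_anti TC2 _ TD2); last first.
    by rewrite /indep /=; lia.
  by rewrite hB // fop0 oppr0 fop0 oppr0.
- by rewrite (@fop_anti TC2 _ TC1) // (@fop_anti TC2 _ TD3) // hB // fop0 oppr0 fop0 oppr0.
- by rewrite (@fop_anti TC2 _ TC2) // (@fop_anti TC2 _ TD3) // hB // fop0 oppr0 fop0 oppr0.
Qed.

Lemma vanish_C1 F : vanish TC1 (-1) F.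
Proof. by exists 0%N => k hk; rewrite fop_out //=; lia. Qed.

Lemma vanish_D3 F : vanish TD3 1 F.
Proof. by exists 0%N => k hk; rewrite fop_out //=; lia. Qed.

Lemma fopE t k F m : fop t k F m =
  if inrange t k && (m (line t, k) == sgn t)
  then sg (line t, k) m * F (upd m (line t, k) (~~ sgn t)) else 0.
Proof. by rewrite /fop; case: ifP. Qed.

Section Kill.
Variables (M N : int) (S T : pred int) (d : int).

(* Under these bounds every e_i (i >= M) and f_j (j >= N) would have to empty a
   vacant site or fill an occupied one of the second row. *)
Record adm : Prop := Adm {
  admM : 0 <= M + d;
  admN : 0 <= N - d;
  admP : M + N <= P%:Z;
  admS : forall p, S p -> 1 <= p <= M + d;
  admT : forall q, T q -> - (N - d) < q <= 0 }.

Hypothesis had : adm.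

Lemma kill g F : gMN_gen M N g -> gop g F (sea S d T) = 0.
Proof.
case: g => k i; rewrite /gMN_gen /= => /orP[] /andP[/eqP -> hi];
  rewrite /gop /= fock_sumE big1 // => p _.
- rewrite fopE /=; case: ifP => // /andP[_ /eqP /(admS had) /= hp].
  rewrite fopE upd_ne //= /sea /= ifN ?mulr0 //.
  by apply/negP => /eqP /negP; lia.
- rewrite fopE /=; case: ifP => // /eqP hp.
  rewrite fopE upd_ne //=; case: ifP => [/andP[_ /eqP]|_]; last by rewrite mulr0.
  by move=> /(admT had) /= hq; move: hp; rewrite /sea /=; lia.
Qed.

(** If M = -1 then d > 0, if N = -1 then d < 0, whereas the second row of the vacuum is filled up to
    0. *)
Lemma kill_v : (M == -1) || (N == -1) -> rho [::] (sea S d T) = 0.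
Proof.
move=> h; rewrite /rho /= /v0 asboolF // => e.
have e2 k := congr1 (fun c : conf => c (None, k)) e.
have d0 : d = 0.
  by have := e2 d; have := e2 0; rewrite /sea /=; lia.
by move: (admM had) (admN had); rewrite d0; lia.
Qed.

End Kill.

Definition ins (S : pred int) (x : int) : pred int := fun y => (y == x) || S y.

(** f_{N-1} joins hole q to second-row site q + N - 1, which must be at most d. All holes of [T] lie
    above d - N + 1, so only the added hole contributes, and it removes the top particle, at d. *)
Lemma lift_f M N S d' T : M + N <= P%:Z -> adm (M + 1) (N - 2) S T d' ->
  let d := d' + 1 in let T' := ins T (d - N + 1) in
  adm M N S T' d /\ exists2 e : K, e != 0 &
    forall w, rho ((KF, N - 1) :: w) (sea S d T') = e * rho w (sea S d' T).
Proof.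
move=> hP had d T'; have [h1 h2 h3 hS hT] := had.
pose q0 := d - N + 1.
split.
  split; rewrite /d; try lia.
  - by move=> p /hS; lia.
  - by move=> q /orP[/eqP ->|/hT]; lia.
have q0r : q0 \in sites3 by rewrite mem_sites3 /q0 /d /=; lia.
have hd : sea S d T' (None, q0 + (N - 1)) by rewrite /sea /q0 /=; lia.
have hq0 : ins T (d - N + 1) q0 by rewrite /ins eqxx.
(* The factor is the product of the two Jordan-Wigner signs of the surviving term. *)
exists (sg (None, q0 + (N - 1)) (sea S d T') *
  sg (Some false, q0) (upd (sea S d T') (None, q0 + (N - 1)) false)).
  by rewrite mulf_neq0 ?sg_neq0.
move=> w; rewrite /rho /= -/(rho w) {1}/gop /= fock_sumE.
rewrite (bigD1_seq q0 q0r uniq_sites3) /= big_seq_cond big1 ?addr0; last first.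
  move=> q /andP[hq qq0]; rewrite fopE /=; case: ifP => // /eqP h.
  rewrite fopE upd_ne //=; case: ifP => [/andP[_ /eqP]|_]; last by rewrite mulr0.
  rewrite /sea /= /T' /ins => /orP[/eqP e|/hT]; first by rewrite /q0 e eqxx in qq0.
  by move: h; rewrite /sea /= /d; lia.
rewrite fopE [_ && _]/= hd eqxx fopE -mem_sites3 q0r upd_ne //=.
rewrite [sea S d T' (Some false, q0)]hq0 eqxx mulrA; congr (_ * rho w _).
apply/funext => -[[[]|] k]; rewrite /upd /sea /=.
- by [].
- rewrite !xpair_eqE /= /T' /ins.
  have [->|//] := eqVneq k q0.
  by apply/esym/negP => /hT; rewrite /q0 /d; lia.
- by rewrite !xpair_eqE /=; case: eqP; rewrite /q0 /d; lia.
Qed.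

(** Mirror image of [lift_f]: only the added particle at M + d contributes, and it refills the
    second row at d + 1. *)
Lemma lift_e M N S d' T : M + N <= P%:Z -> adm (M - 2) (N + 1) S T d' ->
  let d := d' - 1 in let S' := ins S (M + d) in
  adm M N S' T d /\ exists2 e : K, e != 0 &
    forall w, rho ((KE, M - 1) :: w) (sea S' d T) = e * rho w (sea S d' T).
Proof.
move=> hP had d S'; have [h1 h2 h3 hS hT] := had.
pose p0 := M + d.
split.
  split; rewrite /d; try lia.
  - by move=> p /orP[/eqP ->|/hS] /=; lia.
  - by move=> q /hT; lia.
have p0r : p0 \in sites1 by rewrite mem_sites1 /p0 /d /=; lia.
have hd : sea S' d T (None, p0 - (M - 1)) = false by rewrite /sea /p0 /=; lia.
have hp0 : sea S' d T (Some true, p0) by rewrite /sea /= /S' /ins eqxx.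
exists (sg (Some true, p0) (sea S' d T) *
  sg (None, p0 - (M - 1)) (upd (sea S' d T) (Some true, p0) false)).
  by rewrite mulf_neq0 ?sg_neq0.
move=> w; rewrite /rho /= -/(rho w) {1}/gop /= fock_sumE.
rewrite (bigD1_seq p0 p0r uniq_sites1) /= big_seq_cond big1 ?addr0; last first.
  move=> p /andP[hp pp0]; rewrite fopE /=; case: ifP => // /andP[_ /eqP h].
  rewrite fopE upd_ne //=; case: ifP => [/eqP|_]; last by rewrite mulr0.
  move: h; rewrite /sea /= /S' /ins => /orP[/eqP e|/hS]; first by rewrite /p0 e eqxx in pp0.
  by rewrite /d; lia.
rewrite fopE -mem_sites1 p0r /= hp0 eqxx fopE upd_ne //= hd eqxx.
rewrite mulrA; congr (_ * rho w _).
apply/funext => -[[[]|] k]; rewrite /upd /sea /=.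
- rewrite !xpair_eqE /= /S' /ins.
  have [->|//] := eqVneq k p0.
  by apply/esym/negP => /hS; rewrite /p0 /d; lia.
- by [].
- by rewrite !xpair_eqE /=; case: eqP; rewrite /p0 /d; lia.
Qed.

Hypothesis two_neq0 : (2%:R : K) != 0.

(** The inner vector depends only on p + q, so exchanging p and q changes the sign of the sum; 2 is
    invertible. *)
Lemma sum_antisym Z (r : seq int) (g : int -> fock) :
  \sum_(p <- r) \sum_(q <- r) fop Z p (fop Z q (g (p + q))) = 0.
Proof.
set S := LHS; have hS : S = - S.
  rewrite {1}/S exchange_big -sumrN; apply: eq_bigr => q _.
  rewrite -sumrN; apply: eq_bigr => p _.
  by rewrite addrC fop_anti // /indep !eqxx.
apply/funext => m; have := congr1 (fun F : fock => F m) hS; rewrite !fockE => /eqP.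
by rewrite -addr_eq0 -mulr2n -mulr_natl mulf_eq0 (negPf two_neq0) => /eqP.
Qed.

(* Reindexing by the position k = p + s i of the second operator makes the
   range of summation independent of p, after which the sum is antisymmetric. *)
Lemma field_sq Z g1 g2 (s n : int) (r : seq int) F :
  s * s = 1 -> (forall k l, indep g1 k Z l) ->
  (forall k l, indep g1 k g2 l) -> vanish g1 s F -> vanish g2 s F ->
  exists B0 : nat, forall B, (B0 <= B)%N ->
  \sum_(i <- int_ball B) \sum_(p <- r) fop Z p (fop g1 (p - s * i)
    (\sum_(q <- r) fop Z q (fop g2 (q - s * (n - i)) F))) = 0.
Proof.
move=> ss h1 h12 [B1 hB1] [B2 hB2].
pose C := \sum_(p <- r) `|p|%N.
have hC p : p \in r -> (`|p| <= C)%N.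
  by move=> hp; rewrite /C (big_rem p) //= leq_addr.
pose G c k := fop g1 k (fop g2 (c - s * n - k) F).
pose B' := (B1 + B2 + C + C + `|n|)%N.
(* For negative [s * k] the operator [g2] sits far out in the direction [s]; otherwise [g1] does,
   after being anticommuted inside. *)
have hG c k : (`|c| <= C + C)%N -> (B' < `|k|)%N -> G c k = 0.
  rewrite /G /B' => hc hk; case: (ltrP (s * k) 0) => hs.
    by rewrite hB2 ?fop0 //; case/eqP: ss; rewrite -expr2 sqrf_eq1 => /orP[]/eqP es;
      rewrite es in hs *; lia.
  rewrite fop_anti // hB1 ?fop0 ?oppr0 //.
  by case/eqP: ss; rewrite -expr2 sqrf_eq1 => /orP[]/eqP es; rewrite es in hs *; lia.
exists (B' + C)%N => B hB.
transitivity (- \sum_(p <- r) \sum_(q <- r)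
   fop Z p (fop Z q (\sum_(k <- int_ball B') G (p + q) k))); last first.
  by rewrite (sum_antisym Z r (fun c => \sum_(k <- int_ball B') G c k)) oppr0.
rewrite exchange_big -sumrN big_seq [RHS]big_seq; apply: eq_bigr => p hp.
under eq_bigr => i _ do rewrite !fop_sum.
rewrite exchange_big -sumrN big_seq [RHS]big_seq; apply: eq_bigr => q hq.
transitivity (- fop Z p (fop Z q (\sum_(i <- int_ball B) G (p + q) (p - s * i)))).
  rewrite !fop_sum -sumrN; apply: eq_bigr => i _.
  rewrite (fop_anti _ (h1 _ _)) fopN /G.
  by have -> : p + q - s * n - (p - s * i) = q - s * (n - i) by ring.
have -> : \sum_(i <- int_ball B) G (p + q) (p - s * i) =
    \sum_(k <- [seq p - s * i | i <- int_ball B]) G (p + q) k by rewrite [RHS]big_map.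
congr (- _); congr (fop _ _ _); congr (fop _ _ _); apply: sum_window.
- rewrite map_inj_uniq ?uniq_int_ball // => x y /addrI /oppr_inj.
  by move/(congr1 (fun z => s * z)); rewrite !mulrA ss !mul1r.
- exact: uniq_int_ball.
- move=> k _; rewrite mem_int_ball -ltnNge => hk; apply: hG => //.
  by have := hC p hp; have := hC q hq; lia.
- move=> k; rewrite mem_int_ball => hk /negP[]; apply/mapP; exists (s * (p - k)).
    rewrite mem_int_ball abszM (_ : `|s|%N = 1%N); last first.
      by case/eqP: ss; rewrite -expr2 sqrf_eq1 => /orP[]/eqP ->.
    by have := hC p hp; lia.
  by rewrite mulrA ss mul1r; ring.
Qed.

(** The common factor [Z] of [field_sq] is [TC1] for ee, eh and hh, and [TD3] for ff and fh. *)
Lemma gop_rel k1 k2 n w : (k1, k2) \in relpairs ->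
  exists B0 : nat, forall B, (B0 <= B)%N ->
  \sum_(i <- int_ball B) gop (k1, i) (gop (k2, n - i) (rho w)) = 0.
Proof.
have A t1 t2 : (forall k l, indep t1 k TC1 l) -> (forall k l, indep t1 k t2 l) ->
    vanish t1 1 (rho w) -> vanish t2 1 (rho w) ->
    exists B0 : nat, forall B, (B0 <= B)%N ->
    \sum_(i <- int_ball B) \sum_(p <- sites1) fop TC1 p (fop t1 (p - i)
      (\sum_(q <- sites1) fop TC1 q (fop t2 (q - (n - i)) (rho w)))) = 0.
  move=> h1 h2 h3 h4.
  have [B0 h] := field_sq n (sites1) (erefl (1 * 1)) h1 h2 h3 h4.
  exists B0 => B /h hB; rewrite -[RHS]hB; apply: eq_bigr => i _.
  by apply: eq_bigr => p _; under [in RHS]eq_bigr => q _ do rewrite mul1r; rewrite mul1r.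
have flip t F i : (forall k l, indep t k TD3 l) ->
    \sum_(q <- sites3) fop t (q + i) (fop TD3 q F) =
    - \sum_(q <- sites3) fop TD3 q (fop t (q - -1 * i) F).
  move=> h; rewrite -sumrN; apply: eq_bigr => q _.
  by rewrite fop_anti // mulN1r opprK.
have B t1 t2 : (forall k l, indep t1 k TD3 l) -> (forall k l, indep t2 k TD3 l) ->
    (forall k l, indep t1 k t2 l) ->
    vanish t1 (-1) (rho w) -> vanish t2 (-1) (rho w) ->
    exists B0 : nat, forall B, (B0 <= B)%N ->
    \sum_(i <- int_ball B) \sum_(p <- sites3) fop t1 (p + i) (fop TD3 p
      (\sum_(q <- sites3) fop t2 (q + (n - i)) (fop TD3 q (rho w)))) = 0.
  move=> h1 h1' h2 h3 h4.
  have [B0 h] := field_sq n (sites3) (erefl (-1 * -1)) h1 h2 h3 h4.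
  exists B0 => B /h hB; rewrite -[RHS]hB; apply: eq_bigr => i _.
  rewrite flip // -sumrN; apply: eq_bigr => q _.
  by rewrite flip // !fopN opprK.
have vC1 := vanish_C1 (rho w); have vD3 := vanish_D3 (rho w).
have vC2 := vanish_C2 w; have vD2 := vanish_D2 w.
case: k1; case: k2 => // _; try by apply: A.
- have [B0 h] := @B TC2 TC1 (fun _ _ => isT) (fun _ _ => isT) (fun _ _ => isT) vC2 vC1.
  exists B0 => B' /h hB; rewrite -[RHS]hB; apply: eq_bigr => i _.
  by rewrite gopH.
- by apply: B.
Qed.

Lemma R_null m u : Rgen u -> null (fun w => rho w m) u.
Proof.
case=> [k1 [k2 [n [w [L [len [hr [hout ->]]]]]]]].
pose col_word t := (k1, L + t%:Z) :: (k2, n - (L + t%:Z)) :: w.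
exists [seq (1, col_word t) | t <- iota 0 len].
rewrite !big_map (_ : iota 0 len = index_iota 0 len) ?big_mkord; last first.
  by rewrite /index_iota subn0.
split.
  rewrite (@fct_sumE _ _ K); apply/funext => x; apply: eq_bigr => t _.
  by rewrite mul1r.
under eq_bigr => t _ do rewrite mul1r.
rewrite -(@fock_sumE _ _ _ (fun t : 'I_len => rho (col_word t))).
pose f i := rho ((k1, i) :: (k2, n - i) :: w).
have -> : \sum_(t < len) rho (col_word t) = \sum_(i <- [seq L + t%:Z | t <- iota 0 len]) f i.
  rewrite big_map (_ : iota 0 len = index_iota 0 len) ?big_mkord //.
  by rewrite /index_iota subn0.
have [B0 h0] := gop_rel n w hr; have [B1 h1] := rel_bound K n w hr.
rewrite (@sum_window _ _ _ (int_ball (B0 + B1))).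
- by rewrite h0 ?leq_addr.
- by rewrite map_inj_uniq ?iota_uniq // => x y; lia.
- exact: uniq_int_ball.
- by move=> i _; rewrite mem_int_ball => hi; apply: MH_rho; apply: h1; lia.
- move=> i _ hi; apply: MH_rho; apply: hout.
  have [|hL] := ltrP i L; first by left.
  right; rewrite leNgt; apply: contra hi => hi.
  by apply/mapP; exists (absz (i - L)); rewrite ?mem_iota; lia.
Qed.

Lemma W_null M N S T d u : adm M N S T d ->
  @Wker K M N u -> null (fun w => rho w (sea S d T)) u.
Proof.
move=> had; move: u; apply: spanP_min; first exact: subspace_null.
apply: (Wgen_sub (@subspace_null _) (linop_id K)) => //.
- by move=> v; apply: MH_null.
- by move=> v; apply: R_null.
- by move=> g w hg; apply: null_dlt; apply: (kill had).
- by move=> h; apply: null_dlt; apply: (kill_v had).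
Qed.

End Fermions.

(** * Independent functionals and spanning words *)

Section Family.
Variables (K : fieldType) (P : nat).
Local Notation rho := (rho K P).

Definition independent (I : finType) (m : I -> conf) :=
  forall c : I -> K, (forall w, \sum_i c i * rho w (m i) = 0) -> forall i, c i = 0.

(** Block triangularity: words [g :: w] kill the first family and turn the second into [m2'] up to
    nonzero factors, so its coefficients vanish first. *)
Lemma independent_sum g (I1 I2 : finType) m1 m2 m2' :
  @independent I1 m1 -> @independent I2 m2' ->
  (forall i w, rho (g :: w) (m1 i) = 0) ->
  (forall i, exists2 e : K, e != 0 & forall w, rho (g :: w) (m2 i) = e * rho w (m2' i)) ->
  independent (fun i : I1 + I2 => match i with inl i => m1 i | inr i => m2 i end).
Proof.
move=> h1 h2 hk hl c hc.
have /choice[e he] : forall i, exists e : K, e != 0 /\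
    forall w, rho (g :: w) (m2 i) = e * rho w (m2' i).
  by move=> i; have [e] := hl i; exists e.
have {}hc w : \sum_i c (inl i) * rho w (m1 i) + \sum_i c (inr i) * rho w (m2 i) = 0.
  by rewrite -[RHS](hc w) big_sumType.
have c2 i : c (inr i) = 0.
  have : c (inr i) * e i = 0.
    apply: (h2 (fun i => c (inr i) * e i)) => w.
    have := hc (g :: w); rewrite big1 ?add0r => [h|j _].
      by rewrite -[RHS]h; apply: eq_bigr => j _; rewrite (he j).2 mulrA.
    by rewrite hk mulr0.
  by move/eqP; rewrite mulf_eq0 (negPf (he i).1) orbF => /eqP.
have c1 i : c (inl i) = 0.
  apply: (h1 (fun i => c (inl i))) => w.
  have := hc w; rewrite [X in _ + X]big1 ?addr0 // => j _.
  by rewrite c2 mul0r.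
by case.
Qed.

Lemma independent_unit m w : rho w m != 0 -> independent (fun _ : unit => m).
Proof.
move=> hw c /(_ w); rewrite (bigD1 tt) //= big1 ?addr0 => [/eqP|[]//].
by rewrite mulf_eq0 (negPf hw) orbF => /eqP h [].
Qed.

(** All M, N >= -1 are allowed because the recursion leaves the range of M in the theorem. *)
Lemma independent_family n (M N : int) : -1 <= M -> -1 <= N -> M + N = n.+1%:Z -> (n < P)%N ->
  exists (I : finType) (S T : I -> pred int) (d : I -> int),
  [/\ #|I| = (2 ^ n)%N, forall i, adm P M N (S i) (T i) (d i) &
      independent (fun i => sea (S i) (d i) (T i))].
Proof.
elim: n M N => [|n ih] M N hM hN hMN hP; have hMP : M + N <= P%:Z by lia.
  have h00 : adm P 0 0 pred0 pred0 0 by split=> //; lia.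
  have unit_fam S T d w : adm P M N S T d -> rho w (sea S d T) != 0 ->
      exists (I : finType) (S T : I -> pred int) (d : I -> int),
      [/\ #|I| = (2 ^ 0)%N, forall i, adm P M N (S i) (T i) (d i) &
          independent (fun i => sea (S i) (d i) (T i))].
    move=> h1 h2; exists unit, (fun=> S), (fun=> T), (fun=> d).
    by split; [rewrite card_unit|by []|exact: (@independent_unit _ w)].
  have hv : rho [::] (sea pred0 0 pred0) != 0 by rewrite rho_nil_sea oner_neq0.
  (* For M + N = 1 the vacuum is admissible except at (-1,2) and (2,-1), where it is lifted from
     (0,0) by f_1 or e_1. *)
  have [e2|n2] := eqVneq N 2.
    have h0 : adm P (M + 1) (N - 2) pred0 pred0 0.
      by split=> //; lia.
    have [h [e he hl]] := lift_f K hMP h0.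
    by apply: (unit_fam _ _ _ [:: (KF, N - 1)] h); rewrite hl mulf_neq0.
  have [e2|n2'] := eqVneq M 2.
    have h0 : adm P (M - 2) (N + 1) pred0 pred0 0.
      by split=> //; lia.
    have [h [e he hl]] := lift_e K hMP h0.
    by apply: (unit_fam _ _ _ [:: (KE, M - 1)] h); rewrite hl mulf_neq0.
  by apply: (unit_fam pred0 pred0 0 [::]) => //; split=> //; lia.
have combine M1 N1 M2 N2 g (l : pred int -> pred int -> int -> pred int * pred int * int) :
    -1 <= M1 -> -1 <= N1 -> -1 <= M2 -> -1 <= N2 -> M1 + N1 = n.+1%:Z -> M2 + N2 = n.+1%:Z ->
    gMN_gen M1 N1 g ->
    (forall S T d, adm P M1 N1 S T d -> adm P M N S T d) ->
    (forall S T d, adm P M2 N2 S T d -> adm P M N (l S T d).1.1 (l S T d).1.2 (l S T d).2 /\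
      exists2 e : K, e != 0 & forall w,
        rho (g :: w) (sea (l S T d).1.1 (l S T d).2 (l S T d).1.2)
        = e * rho w (sea S d T)) ->
    exists (I : finType) (S T : I -> pred int) (d : I -> int),
    [/\ #|I| = (2 ^ n.+1)%N, forall i, adm P M N (S i) (T i) (d i) &
      independent (fun i => sea (S i) (d i) (T i))].
  move=> hM1 hN1 hM2 hN2 hs1 hs2 hg hmono hlift.
  have [I1 [S1 [T1 [d1 [c1 a1 i1]]]]] := ih M1 N1 hM1 hN1 hs1 (ltnW hP).
  have [I2 [S2 [T2 [d2 [c2 a2 i2]]]]] := ih M2 N2 hM2 hN2 hs2 (ltnW hP).
  pose L i := l (S2 i) (T2 i) (d2 i).
  exists (I1 + I2)%type,
    (fun i => match i with inl i => S1 i | inr i => (L i).1.1 end),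
    (fun i => match i with inl i => T1 i | inr i => (L i).1.2 end),
    (fun i => match i with inl i => d1 i | inr i => (L i).2 end).
  split; first by rewrite card_sum c1 c2 expnS mul2n addnn.
    by case=> i; [apply: hmono|have [] := hlift _ _ _ (a2 i)].
  have := @independent_sum g I1 I2 (fun i => sea (S1 i) (d1 i) (T1 i))
     (fun i => sea (L i).1.1 (L i).2 (L i).1.2) (fun i => sea (S2 i) (d2 i) (T2 i)) i1 i2.
  move=> h c hc; apply: h.
  - by move=> i w; apply: (kill (a1 i)).
  - by move=> i; have [] := hlift _ _ _ (a2 i).
  - by move=> w; rewrite -[RHS](hc w); apply: eq_bigr => -[].
(* For N >= 1 one splits along f_{N-1}; otherwise M >= 2 and one splits along e_{M-1}, which keeps
   all indices at least -1. *)
have [hN1|hN1] := lerP 1 N.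
- apply: (@combine M (N - 1) (M + 1) (N - 2) (KF, N - 1)
    (fun S T d => (S, ins T (d + 1 - N + 1), d + 1))); try lia.
  + by rewrite /gMN_gen /= lexx.
  + move=> S T d [h1 h2 h3 h4 h5]; split; try lia; first exact: h4.
    by move=> q /h5; lia.
  + by move=> S T d h; apply: lift_f => //; lia.
- apply: (@combine (M - 1) N (M - 2) (N + 1) (KE, M - 1)
    (fun S T d => (ins S (M + (d - 1)), T, d - 1))); try lia.
  + by rewrite /gMN_gen /= lexx.
  + move=> S T d [h1 h2 h3 h4 h5]; split; try lia; last exact: h5.
    by move=> q /h4; lia.
  + by move=> S T d h; apply: lift_e => //; lia.
Qed.

End Family.

Section Spanning.
Variable K : fieldType.
Hypothesis two_neq0 : (2%:R : K) != 0.

Definition words fin M a b g L (w : word) : Prop :=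
  exists s, [/\ size s = L, accepts fin a b g s & w = col_word M s].

Section Step.
Variables (fin : bool -> bool -> bool -> bool) (M : int).
Hypothesis fin_imp : fin true false true -> fin false false true.
Local Notation A := (words fin M false false false).
Local Notation B := (words fin M true false true).

Lemma col_word_cons c s : (M != 1) || (0 < size s)%N ->
  col_word M (c :: s) =
    opt c.2 (KH, (size s)%:Z) ++ opt c.1 (KF, (size s)%:Z - M) ++ col_word M s.
Proof. by move=> h; rewrite /= ifN //; move: h; rewrite negb_and lt0n. Qed.

(** [A L] belongs to W^{M,L-M} and [B L] to W^{M+1,L-M-1}; prepending columns realizes the maps
    h_{M+N} and f_{N-1} of the exact sequences. *)
Lemma words_step L : -1 <= M -> 0 <= L%:Z - M -> (M != 1) || (0 < L)%N ->
  spans K M (L%:Z - M) (A L) -> spans K (M + 1) (L%:Z - M) (B L.+1) ->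
  spans K (M + 1) (L%:Z - M - 1) (B L) ->
  spans K M (L.+1%:Z - M) (A L.+1) /\ spans K (M + 1) (L.+1%:Z - M) (B L.+2).
Proof.
move=> hM hL hl hA hB1 hB.
have eN : L.+1%:Z - M - 1 = L%:Z - M by lia.
have eN2 : L.+1%:Z - M - 2 = L%:Z - M - 1 by lia.
rewrite -eN in hA hB1; rewrite -eN2 in hB.
have hN : 1 <= L.+1%:Z - M by lia.
split.
- apply: (spans_A two_neq0 hM hN hA hB) => _ [s [hs ha ->]].
  + exists ((false, false) :: s); split; rewrite ?col_word_cons ?hs //=.
    by rewrite hs.
  + exists ((true, false) :: s); split; rewrite ?col_word_cons ?hs //=; first by rewrite hs.
    by rewrite eN.
- apply: (spans_B two_neq0 hM hN hA hB hB1) => _ [s [hs ha ->]].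
  + exists ((false, true) :: (false, false) :: s); split; [by rewrite /= hs|by []|].
    rewrite !col_word_cons /= ?hs ?orbT //.
    by rewrite (_ : M + (L.+1%:Z - M) = L.+1%:Z) //; lia.
  + exists ((false, false) :: (true, false) :: s); split; [by rewrite /= hs|by []|].
    by rewrite !col_word_cons /= ?hs ?orbT // eN.
  + exists ((false, false) :: s); split; first by rewrite /= hs.
      (* No [a] can follow directly below an [a], so acceptance from the state [true false true]
         implies acceptance from [false false true]; [fin_imp] covers the empty sequence. *)
      by case: s {hs} ha => [|[[] []] s] //=.
    by rewrite col_word_cons ?hs ?orbT.
Qed.

Lemma words_spans L0 : -1 <= M -> 0 <= L0%:Z - M -> (M != 1) || (0 < L0)%N ->
  spans K M (L0%:Z - M) (A L0) -> spans K (M + 1) (L0%:Z - M) (B L0.+1) ->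
  spans K (M + 1) (L0%:Z - M - 1) (B L0) ->
  forall L, (L0 <= L)%N -> spans K M (L%:Z - M) (A L).
Proof.
move=> hM hL hl hA hB1 hB L /subnK <-; move: (L - L0)%N => k.
suff [] : [/\ spans K M ((k + L0)%N%:Z - M) (A (k + L0)),
  spans K (M + 1) ((k + L0)%N%:Z - M) (B (k + L0).+1) &
  spans K (M + 1) ((k + L0)%N%:Z - M - 1) (B (k + L0))] by [].
elim: k => [|k [h1 h2 h3]]; first by split.
have [||h4 h5] := words_step hM _ _ h1 h2 h3; try lia.
rewrite addSn; split=> //.
by rewrite (_ : (k + L0).+1%:Z - M - 1 = (k + L0)%N%:Z - M) //; lia.
Qed.

End Step.

Lemma spans_0 (N : int) : 0 <= N -> spans K 0 N (words fin0 0 false false false `|N|).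
Proof.
move=> hN; have := @words_spans fin0 0 _ 0 _ _ _ _ _ _ `|N|%N.
rewrite gez0_abs // !subr0 add0r; apply => //.
- apply: spans_sub_ws (spans_0_0 K) => w <-; by exists [::].
- apply: spans_sub_ws (spans_1_0 K) => w <-; by exists [:: (false, false)].
- by apply: spans_v => //; right.
Qed.

(** The induction starts with one column, since column 0 carries e_1^{1-a_0}. *)
Lemma spans_1 (N : int) : 0 <= N ->
  spans K 1 N (words fin1 1 false false false (absz (N + 1))).
Proof.
move=> hN; have := @words_spans fin1 1 _ 1 _ _ _ _ _ _ (absz (N + 1)).
rewrite gez0_abs ?addrK ?subrr; last by lia.
apply => //; last by lia.
- apply: spans_sub_ws (spans_1_0 K) => w <-; by exists [:: (true, false)].
- apply: spans_sub_ws (spans_2_0 K) => w [->|->].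
    by exists [:: (false, false); (true, false)].
  by exists [:: (false, false); (false, false)].
- apply: spans_sub_ws (spans_2_N1 K) => w <-; by exists [:: (false, false)].
Qed.

Lemma spans_N1 (N : int) : 1 <= N ->
  spans K (-1) N (words fin1 (-1) false false false (absz (N - 1))).
Proof.
move=> hN; have := @words_spans fin1 (-1) _ 0 _ _ _ _ _ _ (absz (N - 1)).
have h1 ws : spans K (-1) 0 ws by apply: spans_v => //; left.
have h2 ws : spans K 0 (-1) ws by apply: spans_v => //; right.
rewrite gez0_abs; last by lia.
rewrite opprK subrK addNr; apply => //.
(* W^{-1,1} is zero, as W^{-1,0} and W^{0,-1} are; the same two zero spaces leave only v to span
   W^{0,1}. *)
- apply: (@spans_A K two_neq0 (-1) 1 isT isT _ (fun=> False) (fun=> False)) => //.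
- apply: (@spans_B K two_neq0 (-1) 1 isT isT (fun=> False) _ (eq [::]) (fun=> False)) => //.
    exact: spans_0_0.
  by move=> w <-; exists [:: (false, false)].
- apply: spans_sub_ws (spans_0_0 K) => w <-; by exists [::].
Qed.

End Spanning.

(** * From spanning words and independent functionals to a basis *)

Section Final.
Variable K : fieldType.

Lemma quo_coef (M N : int) (I : finType) (C : {set I}) (t : I -> word) (u : vec K) :
  quo M N (fun w => exists2 y, y \in C & w = t y) u ->
  exists c : I -> K, Wker M N (fun x => u x - \sum_(y in C) c y * dlt K (t y) x).
Proof.
have hW : subspace (@Wker K M N) by apply: subspace_spanP.
pose Q (u : vec K) := exists c : I -> K,
  Wker M N (fun x => u x - \sum_(y in C) c y * dlt K (t y) x).
move: u; apply: (@spanP_min K _ Q).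
  split.
  - exists (fun=> 0); rewrite (_ : (fun x => _) = 0); first exact: sub0 hW.
    by apply/funext => x; rewrite big1 ?subr0 // => y _; rewrite mul0r.
  - move=> u v [c hc] [c' hc']; exists (fun y => c y + c' y).
    rewrite (_ : (fun x => _) = (fun x => u x - \sum_(y in C) c y * dlt K (t y) x) +
      (fun x => v x - \sum_(y in C) c' y * dlt K (t y) x)); first exact: subD hW _ _ hc hc'.
    apply/funext => x; rewrite !vecE.
    under eq_bigr => y _ do rewrite mulrDl.
    by rewrite big_split /=; ring.
  - move=> a u [c hc]; exists (fun y => a * c y).
    have := subZ hW a hc; congr Wker; apply/funext => x.
    by rewrite mulrBr mulr_sumr; under eq_bigr => y _ do rewrite mulrA.
move=> u [hu|[_ [y yC ->] ->]].
  exists (fun=> 0); rewrite (_ : (fun x => _) = u); first exact: spanG.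
  by apply/funext => x; rewrite big1 ?subr0 // => y _; rewrite mul0r.
exists (fun z => (z == y)%:R); rewrite (_ : (fun x => _) = 0); first exact: sub0 hW.
apply/funext => x; rewrite (bigD1 y) //= eqxx mul1r big1 ?addr0 ?subrr //.
move=> z /andP[_ /negPf ->].
by rewrite mul0r.
Qed.

(** The scalar [a] serves two uses: 1 for the expression of a word, 0 for a linear relation among
    the [t y]. *)
Lemma sum_null (phi : word -> K) (I : finType) (C : {set I}) (t : I -> word) (c : I -> K)
    (w : word) (a : K) :
  null phi (fun x => a * dlt K w x - \sum_(y in C) c y * dlt K (t y) x) ->
  a * phi w = \sum_(y in C) c y * phi (t y).
Proof.
pose s := (a, w) :: [seq (- c y, t y) | y <- enum C].
move=> h; have {}h : null phi (\sum_(cw <- s) (fun x => cw.1 * dlt K cw.2 x)).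
  move: h; congr null; rewrite big_cons big_map big_enum /=.
  apply/funext => x; rewrite vecE (@fct_sumE _ _ K) -sumrN; congr (_ + _).
  by apply: eq_bigr => y _; rewrite mulNr.
move: (null_sum h); rewrite big_cons big_map big_enum /= => /eqP.
by under eq_bigr => y _ do rewrite mulNr; rewrite sumrN subr_eq0 => /eqP.
Qed.

(* A square system: the functionals [phi i] are independent and the vectors
   [t y] span, so the matrix [phi i (t y)] is invertible. *)
Lemma dual_basis (I J : finType) (C : {set J}) (phi : I -> word -> K) (t : J -> word) :
  #|I| = #|C| ->
  (forall c : I -> K, (forall w, \sum_i c i * phi i w = 0) -> forall i, c i = 0) ->
  (forall w, exists c : J -> K, forall i, phi i w = \sum_(y in C) c y * phi i (t y)) ->
  forall c : J -> K, (forall i, \sum_(y in C) c y * phi i (t y) = 0) ->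
  forall y, y \in C -> c y = 0.
Proof.
move=> hIC hI hC c hc y yC.
pose A : 'M[K]_(#|I|, #|C|) := \matrix_(i, j) phi (enum_val i) (t (enum_val j)).
have fA : row_free A.
  apply: inj_row_free => v hv; apply/rowP => i; rewrite mxE.
  rewrite -[i]enum_valK; apply: (hI (fun x => v ord0 (enum_rank x))) => w.
  have [d hd] := hC w; under eq_bigr => x _ do rewrite hd mulr_sumr.
  rewrite exchange_big /= big1 // => z zC.
  have := congr1 (fun B : 'rV_#|C| => d z * B ord0 (enum_rank_in zC z)) hv.
  rewrite !mxE mulr0 => e0; rewrite -[RHS]e0 mulr_sumr.
  rewrite (reindex (fun i : 'I_#|I| => enum_val i)) /=; last first.
    by exists enum_rank => x _; rewrite ?enum_valK ?enum_rankK.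
  by apply: eq_bigr => j _; rewrite mxE enum_valK enum_rankK_in //; ring.
have /row_fullP[B hB] : row_full A by rewrite /row_full (eqP fA) hIC.
pose cv : 'cV[K]_#|C| := \col_j c (enum_val j).
have hcv : A *m cv = 0.
  apply/colP => i; rewrite !mxE -[RHS](hc (enum_val i)) [RHS]big_enum_val.
  by apply: eq_bigr => j _; rewrite !mxE mulrC.
have : cv = 0 by rewrite -[cv]mul1mx -hB -mulmxA hcv mulmx0.
move/colP => /(_ (enum_rank_in yC y)).
by rewrite !mxE enum_rankK_in.
Qed.

Lemma card_accepts fin n (C : {set seqs n}) :
  (forall x, (x \in C) = accepts fin false false false (cols x)) ->
  #|C| = size (acc_seqs fin n.+1 false false false).
Proof.
move=> hC; rewrite cardE -(size_map (@cols n)); apply: perm_size.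
apply: uniq_perm; rewrite ?uniq_acc_seqs ?map_inj_uniq ?enum_uniq //.
  exact: can_inj (@colsK n).
move=> s; rewrite mem_acc_seqs; apply/mapP/andP => [[x]|[/eqP hs ha]].
  by rewrite mem_enum hC => hx ->; rewrite size_columns_of eqxx.
by exists (uncols n s); rewrite ?mem_enum ?hC ?uncolsK.
Qed.

Lemma accepts_local fin n (x : seqs n) : accepts fin false false false (cols x) ->
  (forall i, (i <= n)%N -> local (rd x.1) (rd x.2) i) /\
  fin (rd x.1 0) (rd x.2 0) (above (rd x.1) (rd x.2) 0).
Proof.
rewrite accepts_cols; try exact: rd_out.
by case/andP => /allP h hf; split=> // i hi; apply: h; rewrite mem_iota.
Qed.

Lemma tau_words fin (M : int) n (C : {set seqs n}) (t : seqs n -> word) w :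
  (forall x, (x \in C) = accepts fin false false false (cols x)) ->
  (forall x, x \in C -> col_word M (cols x) = t x) ->
  words fin M false false false n.+1 w -> exists2 y, y \in C & w = t y.
Proof.
move=> hC ht [s [hs ha ->]]; have e := uncolsK hs.
have hy : uncols n s \in C by rewrite hC e.
by exists (uncols n s); rewrite // -ht // e.
Qed.

Lemma Cset_basis (M N : int) : (2%:R : K) != 0 -> -1 <= M -> -1 <= N -> 1 <= M + N ->
  spans K M N (fun w => exists2 y, y \in Cset M N & w = tau y) ->
  #|Cset M N| = (2 ^ absz (M + N - 1)%R)%N ->
  (forall w : word, exists c : seqs (top M N) -> K,
     @Wker K M N (fun x => @dlt K w x
                   - \sum_(y in Cset M N) c y * @dlt K (@tau M N y) x)) /\
  (forall c : seqs (top M N) -> K,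
     @Wker K M N (fun x => \sum_(y in Cset M N) c y * @dlt K (@tau M N y) x) ->
     forall y, y \in Cset M N -> c y = 0).
Proof.
move=> two_neq0 hM hN hMN hs hcard.
have hsp w := quo_coef (hs w).
split=> // c hc.
pose n := absz (M + N - 1)%R.
have hn : M + N = n.+1%:Z by rewrite /n; lia.
(* The cut-off is [n.+1], that is M + N, the least that admissibility permits. *)
have [I [S [T [d [cI ha hI]]]]] := @independent_family K n.+1 n M N hM hN hn (leqnn _).
pose phi i w := rho K n.+1 w (sea (S i) (d i) (T i)).
apply: (@dual_basis I _ _ phi) => //.
- by rewrite cI hcard.
- move=> w; have [b hb] := hsp w; exists b => i.
  rewrite -[LHS]mul1r; apply: (@sum_null (phi i)).
  have := W_null two_neq0 (ha i) hb.
  by congr null; apply/funext => x; rewrite mul1r.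
- move=> i; rewrite -(@sum_null (phi i) _ _ _ c [::] 0) ?mul0r //.
  have := subN (@subspace_null K (phi i)) (W_null two_neq0 (ha i) hc).
  by congr null; apply/funext => x; rewrite vecE mul0r add0r.
Qed.

End Final.

Theorem theorem5p2p1 (K : fieldType) (hK : [pchar K] =i pred0) (M N : int)
  (hM : M \in [:: -1; 0; 1]) (hN : -1 <= N) (hMN : 1 <= M + N) :
  (* the images of the tau vectors span W^{M,N} *)
  (forall w : word, exists c : seqs (top M N) -> K,
     @Wker K M N (fun x => @dlt K w x
                   - \sum_(y in Cset M N) c y * @dlt K (@tau M N y) x))
  /\
  (* they are linearly independent in W^{M,N} *)
  (forall c : seqs (top M N) -> K,
     @Wker K M N (fun x => \sum_(y in Cset M N) c y * @dlt K (@tau M N y) x) ->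
     forall y, y \in Cset M N -> c y = 0)
  /\
  (* dim W^{M,N} = #|C^{M,N}| = 2^(M+N-1) *)
  #|Cset M N| = (2 ^ absz (M + N - 1)%R)%N.
Proof.
have two_neq0 : (2%:R : K) != 0 by rewrite ((pcharf0P K).1 hK).
have htop : absz (M + N - 1)%R = top M N by rewrite /top; lia.
suff [hs hcard] : spans K M N (fun w => exists2 y, y \in Cset M N & w = tau y) /\
    #|Cset M N| = (2 ^ absz (M + N - 1)%R)%N.
  have hM1 : -1 <= M by move: hM; rewrite !inE => /or3P[] /eqP ->.
  by have [h1 h2] := Cset_basis two_neq0 hM1 hN hMN hs hcard.
rewrite htop.
have key (fin : bool -> bool -> bool -> bool) (L : nat) :
    fin false false true -> fin false true false = false ->
    fin true false true = ~~ fin false false false -> L = (top M N).+1 ->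
    (forall x, (x \in Cset M N) = accepts fin false false false (cols x)) ->
    (forall x, x \in Cset M N -> col_word M (cols x) = tau x) ->
    spans K M N (words fin M false false false L) ->
    spans K M N (fun w => exists2 y, y \in Cset M N & w = tau y) /\
    #|Cset M N| = (2 ^ top M N)%N.
  move=> f1 f2 f3 eL hC ht hs; split; last first.
    by rewrite (card_accepts hC); have [] := @size_acc_seqs fin (top M N) f1 f2 f3.
  by apply: spans_sub_ws hs => w; rewrite eL; apply: tau_words.
move: hM hMN key; rewrite !inE => /or3P[] /eqP -> {M htop} hMN key.
- apply: (key fin1 _ _ _ _ _ _ _ (spans_N1 two_neq0 _)) => //; try lia.
  + by rewrite /top; lia.
  + by move=> x; rewrite -mem_C1.
  + move=> x; rewrite mem_C1 => /accepts_local[hl hg].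
    (* The flag being set at index 0 gives b_0 = 0. *)
    by apply: col_word_taum => //; move: hg; rewrite /fin1 aboveS => /andP[].
- apply: (key fin0 _ _ _ _ _ _ _ (spans_0 two_neq0 _)) => //; try lia.
  + by rewrite /top; lia.
  + by move=> x; rewrite -mem_C0.
  + move=> x; rewrite mem_C0 => /accepts_local[hl /andP[h1 h2]].
    exact: col_word_tau0.
- apply: (key fin1 _ _ _ _ _ _ _ (spans_1 two_neq0 _)) => //; try lia.
  + by rewrite /top; lia.
  + by move=> x; rewrite -mem_C1.
  + by move=> x _; apply: col_word_tau1.
Qed.
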